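(* Let $\tau:I\to I$ be piecewise monotonic and eventually surjective, with associated partition $C=\{a_0,a_1,\ldots,a_n\}$. Let $M$ be any member of the set $\widehat\tau(C)=\{\tau_1(a_0),\tau_1(a_1),\tau_2(a_1),\tau_2(a_2),\ldots,\tau_n(a_{n-1}),\tau_n(a_n)\}$. Let $$\mathcal J_1=\{\,I(c,d)\mid c,d \text{ are adjacent points in } \{a_0,a_1,\ldots,a_n,M\}\,\},$$ and let $$\mathcal J_2=\{\,I(\tau_i(a_i),\tau_{i+1}(a_i))\mid 1\le i\le n-1\,\}.$$ Then $DG(\tau)$ is generated as a $\mathbb Z[t,t^{-1}]$-module by $\mathcal J_1\cup\mathcal J_2$.
   Context: Piecewise monotonic maps. Let $I=[0,1]$. A map $\tau:I\to I$ is piecewise monotonic if there are points $0=a_0<a_1<\dots<a_n=1$ such that $\tau|_{(a_{i-1},a_i)}$ is continuous and strictly monotonic for $1\le i\le n$; $\tau_i:[a_{i-1},a_i]\to I$ denotes the unique continuous extension of $\tau|_{(a_{i-1},a_i)}$ (a homeomorphism onto its range). $C=\{a_0,\dots,a_n\}$ is the partition associated with $\tau$; it is maximal if the intervals $(a_{i-1},a_i)$ are the largest open intervals on which $\tau$ is continuous and strictly monotonic. $\widehat\tau(x)$ denotes the set of left and right limits of $\tau$ at $x$ (identified with $\tau(x)$ where $\tau$ is continuous), $\widehat\tau(A)=\bigcup_{x\in A}\widehat\tau(x)$ and $\widehat\tau^{-1}(A)=\{x\in I\mid \widehat\tau(x)\cap A\ne\emptyset\}$. The generalized orbit $I_1$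 of $C$ is the smallest subset of $I$ containing $C$ and closed under $\widehat\tau$ and $\widehat\tau^{-1}$; $I_0=I\setminus I_1$. Associated local homeomorphism. The disconnection $X$ of $I$ at points of $I_1$ is the totally ordered set obtained from $I$ by replacing each $x\in I_1\setminus\{0,1\}$ by two points $x^-<x^+$, with the order topology (it is homeomorphic to a compact subset of $\mathbb R$); $\pi:X\to I$ is the collapse map, $\pi(x^\pm)=x$ and $\pi(x)=x$ for $x\in I_0$. For any $x\in I$, $x^-$ and $x^+$ denote the smallest and largest points of $\pi^{-1}(x)$ (equal if $x\in I_0\cup\{0,1\}$). For $a,b\in X$, $[a,b]_X=\{x\in X\mid a\le x\le b\}$. With $X_0=\pi^{-1}(I_0)$, the local homeomorphism associated with $\tau$ is the unique continuous map $\sigma:X\to X$ with $\pi\circ\sigma=\tau\circ\pi$ on $X_0$. Dimension group. The transfer map $\mathcal L:C(X,\mathbb Z)\to C(X,\mathbb Z)$ is $(\mathcal Lf)(x)=\sum_{\sigma(y)=x}f(y)$. For $f,g\in C(X,\mathbb Z)$ put $f\sim g$ if $\mathcal L^nf=\mathcal L^ng$ for some $n\ge0$. $DG(\tau)=G_\sigma$ is the group of equivalence classes $[f]$, with $[f]+[g]=[f+g]$ and positive cone $\{[f]\mid f\ge 0\}$; $\mathcal L_*[f]=[\mathcal Lf]$. In the notation $DG(\tau)$ the partition $C$ is taken to be the maximal one. Module structure. A continuous map $f$ is eventually surjective if $f^{n+1}$ and $f^n$ have the same range for some $n\ge0$; if $\tau$ is piecewise monotonic but not continuous, $\tau$ is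 eventually surjective if $\tau|_{I_0}:I_0\to I_0$ is, i.e. $\tau^{n+1}(I_0)=\tau^n(I_0)$ for some $n\geq 0$. For eventually surjective $\tau$, $\mathcal L_*$ is an automorphism of $DG(\tau)$, and $DG(\tau)$ is a $\mathbb Z[t,t^{-1}]$-module with $t$ acting as $\mathcal L_*$. Intervals. For $a,b\in I_1$ with $a<b$, $I(a,b)$ denotes the clopen set $[a^+,b^-]_X$, and also its characteristic function in $C(X,\mathbb Z)$ and the class of that function in $DG(\tau)$; $I(a,b)=I(b,a)$ if $a>b$, and $I(a,a)=0$. Distinct points $x,y$ of a finite set $D\subset\mathbb R$ are adjacent in $D$ if no element of $D$ lies strictly between them. *)

(* Defs.v *)
From HB Require Import structures.
From mathcomp Require Import all_boot all_order all_algebra finmap.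
From mathcomp Require Import all_classical all_reals topology normedtype numfun.

Set Implicit Arguments.
Unset Strict Implicit.
Unset Printing Implicit Defensive.

Import Order.TTheory GRing.Theory Num.Theory.
Import numFieldNormedType.Exports.

Local Open Scope classical_set_scope.
Local Open Scope ring_scope.
Local Open Scope quotient_scope.

Section PiecewiseMonotonic.
Variable R : realType.
Implicit Types (tau : R -> R) (a : nat -> R) (n : nat) (A C : set R).

Definition unit_itv : set R := `[0, 1].

Definition strictly_monotonic_on tau A : Prop :=
  {in A &, forall x y, x < y -> tau x < tau y} \/
  {in A &, forall x y, x < y -> tau y < tau x}.

Definition continuous_monotonic_on tau (u v : R) : Prop :=
  {in `]u, v[, continuous tau} /\ strictly_monotonic_on tau `]u, v[.

(* Maps I -> I are encoded as maps R -> R preserving [0, 1]; values outside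
   [0, 1] are never used.  Only a 0, ..., a n are relevant. *)
Definition pm_partition tau n a : Prop :=
  [/\ a 0%N = 0, a n = 1,
      forall i, (i < n)%N -> a i < a i.+1 &
      forall i, (i < n)%N -> continuous_monotonic_on tau (a i) (a i.+1)].

Definition piecewise_monotonic tau n a : Prop :=
  set_fun unit_itv unit_itv tau /\ pm_partition tau n a.

Definition maximal_partition tau n a : Prop :=
  forall i u v, (i < n)%N -> 0 <= u <= a i -> a i.+1 <= v <= 1 ->
    continuous_monotonic_on tau u v -> u = a i /\ v = a i.+1.

Definition partition_set n a : set R := [set a i | i in [set i | (i <= n)%N]].

(* The continuous extension tau_i of tau to [a_(i-1), a_i], for 1 <= i <= n. *)
Definition branch tau a (i : nat) (x : R) : R :=
  if x == a i.-1 then lim (tau z @[z --> (a i.-1)^'+])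
  else if x == a i then lim (tau z @[z --> (a i)^'-])
  else tau x.

(* The left and right limits of tau at x, taken inside [0, 1]: at a point of
   continuity this is [set tau x]. *)
Definition hat tau (x : R) : set R :=
  [set y | (0 < x /\ tau z @[z --> x^'-] --> y) \/
           (x < 1 /\ tau z @[z --> x^'+] --> y)].

Definition hat_image tau A : set R := \bigcup_(x in A) hat tau x.

Definition hat_preimage tau A : set R :=
  [set x | unit_itv x /\ hat tau x `&` A !=set0].

Definition hat_invariant tau A : Prop :=
  [/\ A `<=` unit_itv, hat_image tau A `<=` A & hat_preimage tau A `<=` A].

Definition generalized_orbit tau C : set R := smallest (hat_invariant tau) C.

Definition orbit_complement tau C : set R :=
  unit_itv `\` generalized_orbit tau C.

Definition range_stabilizes tau A : Prop :=
  exists k : nat, iter k.+1 tau @` A = iter k tau @` A.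

Definition eventually_surjective tau C : Prop :=
  ({within unit_itv, continuous tau} -> range_stabilizes tau unit_itv) /\
  (~ {within unit_itv, continuous tau} ->
     range_stabilizes tau (orbit_complement tau C)).

Definition adjacent A (x y : R) : Prop :=
  [/\ A x, A y, x != y & forall z, A z -> ~ (Num.min x y < z < Num.max x y)].

End PiecewiseMonotonic.

Fact disc_display : Order.disp_t. Proof. exact: Order.Disp tt tt. Qed.

(* The disconnection of [0, 1] at the points of D, inside R x {-, +} ordered
   lexicographically: x^- is (x, false), and (x, true) only belongs to the
   disconnection if x is in D and x is neither 0 nor 1. *)
Section Disconnection.
Variables (R : realType) (D : set R).

Definition split_point (x : R) : bool :=
  [&& x \in D, x != 0 & x != 1].

Definition in_disconnection (p : R *l bool) : bool :=
  (0 <= p.1 <= 1) && (p.2 ==> split_point p.1).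

Record disconnection := Disconnection {
  disc_val : R *l bool;
  disc_valP : in_disconnection disc_val }.

HB.instance Definition _ := [isSub for disc_val].
HB.instance Definition _ := [Choice of disconnection by <:].
HB.instance Definition _ :=
  [SubChoice_isSubOrder of disconnection by <: with disc_display].
HB.instance Definition _ :=
  Topological.copy disconnection (order_topology disconnection).
HB.instance Definition _ := Order_isNbhs.Build _ disconnection
  (@order_nbhs_itv _ disconnection).

Definition collapse (x : disconnection) : R := (disc_val x).1.

Fact disc0P : in_disconnection (0, false).
Proof. by rewrite /in_disconnection /= lexx ler01. Qed.

Definition disc0 : disconnection := Disconnection disc0P.

(* x^- and x^+, for x in [0, 1] (disc0 otherwise). *)
Definition disc_minus (x : R) : disconnection := insubd disc0 (x, false).
Definition disc_plus (x : R) : disconnection :=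
  insubd disc0 (x, split_point x).

End Disconnection.

Section ContinuousInt.
Variable X : topologicalType.

Definition continuous_int : {pred X -> int} :=
  fun f => `[< continuous (f : X -> discrete_topology int) >].

Lemma continuous_int_zmod_closed : zmod_closed continuous_int.
Proof.
have cP (f : X -> int) :
    reflect (forall x, \forall y \near x, f y = f x) (f \in continuous_int).
  pose g : X -> discrete_topology int := f.
  apply: (iffP (asboolP _)) => cf x.
    by have /discrete_cvg : g @ x --> g x by exact: cf.
  suff : g @ x --> g x by [].
  by apply/discrete_cvg; exact: cf.
split; first by apply/cP => x; apply: nearW.
move=> f g /cP cf /cP cg; apply/cP => x.
near=> y; congr (_ - _); near: y; [exact: cf|exact: cg].
Unshelve. all: by end_near. Qed.

HB.instance Definition _ := GRing.isZmodClosed.Build (X -> int) continuous_int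
  continuous_int_zmod_closed.

(* C(X, Z) *)
Record cont_int := ContInt {
  cont_fun :> X -> int;
  cont_funP : cont_fun \in continuous_int }.

HB.instance Definition _ := [isSub for cont_fun].
HB.instance Definition _ := [Choice of cont_int by <:].
HB.instance Definition _ := [SubChoice_isSubZmodule of cont_int by <:].

(* Equal to f when f is continuous (the only case used), 0 otherwise. *)
Definition to_cont_int (f : X -> int) : cont_int := insubd 0 f.

End ContinuousInt.

Section DimensionGroup.
Variables (X : topologicalType) (sigma : X -> X).

(* fset_set A enumerates A when A is finite, and is empty otherwise; the
   fibers of the maps considered here are finite. *)
Definition transfer (f : X -> int) : X -> int :=
  fun x => \sum_(y <- fset_set (sigma @^-1` [set x])) f y.

Lemma iter_transferD k f g :
  iter k transfer (f + g) = iter k transfer f + iter k transfer g.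
Proof.
elim: k => // k IHk; rewrite !iterS IHk; apply/funext => x.
by rewrite /transfer [RHS]/GRing.add /= -big_split.
Qed.

Lemma iter_transferN k f : iter k transfer (- f) = - iter k transfer f.
Proof.
elim: k => // k IHk; rewrite !iterS IHk; apply/funext => x.
by rewrite /transfer [RHS]/GRing.opp /= -sumrN.
Qed.

Definition dg_equiv (f g : cont_int X) : bool :=
  `[< exists k, iter k transfer f = iter k transfer g >].

Lemma dg_equiv_refl : reflexive dg_equiv.
Proof. by move=> f; apply/asboolP; exists 0%N. Qed.

Lemma dg_equiv_sym : symmetric dg_equiv.
Proof. by move=> f g; apply/asboolP/asboolP => -[k fg]; exists k. Qed.

Lemma dg_equiv_trans : transitive dg_equiv.
Proof.
move=> g f h /asboolP[k fg] /asboolP[m gh]; apply/asboolP; exists (m + k)%N.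
by rewrite iterD fg -iterD addnC iterD gh -iterD.
Qed.

Canonical dg_equiv_rel :=
  EquivRel dg_equiv dg_equiv_refl dg_equiv_sym dg_equiv_trans.

Definition dim_group : Type := {eq_quot dg_equiv}.
HB.instance Definition _ := EqQuotient.on dim_group.
HB.instance Definition _ := Choice.on dim_group.

Definition dg_class (f : cont_int X) : dim_group := \pi_dim_group f.

Lemma dg_classP (f g : cont_int X) : dg_class f = dg_class g <->
  exists k, iter k transfer f = iter k transfer g.
Proof. by split => [/eqmodP/asboolP|fg]; last exact/eqmodP/asboolP. Qed.

Definition dg_zero : dim_group := dg_class 0.
Definition dg_opp (u : dim_group) : dim_group := dg_class (- repr u).
Definition dg_add (u v : dim_group) : dim_group := dg_class (repr u + repr v).

Lemma dg_reprP (f : cont_int X) :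
  exists k, iter k transfer (repr (dg_class f)) = iter k transfer f.
Proof. by apply/dg_classP; rewrite /dg_class reprK. Qed.

Lemma dg_classD (f g : cont_int X) :
  dg_add (dg_class f) (dg_class g) = dg_class (f + g).
Proof.
apply/dg_classP; have [k fk] := dg_reprP f; have [m gm] := dg_reprP g.
exists (k + m)%N; rewrite /= !iter_transferD; congr (_ + _).
  by rewrite addnC !iterD fk.
by rewrite !iterD gm.
Qed.

Lemma dg_classN (f : cont_int X) : dg_opp (dg_class f) = dg_class (- f).
Proof.
apply/dg_classP; have [k fk] := dg_reprP f.
by exists k; rewrite /= !iter_transferN fk.
Qed.

Lemma dg_classE (u : dim_group) : exists f, u = dg_class f.
Proof. by exists (repr u); rewrite /dg_class reprK. Qed.

Lemma dg_addA : associative dg_add.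
Proof.
move=> u v w; have [[f ->] [g ->] [h ->]] := And3 (dg_classE u) (dg_classE v)
  (dg_classE w).
by rewrite !dg_classD addrA.
Qed.

Lemma dg_addC : commutative dg_add.
Proof. by move=> u v; rewrite /dg_add addrC. Qed.

Lemma dg_add0 : left_id dg_zero dg_add.
Proof. by move=> u; have [f ->] := dg_classE u; rewrite dg_classD add0r. Qed.

Lemma dg_addN : left_inverse dg_zero dg_opp dg_add.
Proof.
by move=> u; have [f ->] := dg_classE u; rewrite dg_classN dg_classD addNr.
Qed.

HB.instance Definition _ :=
  GRing.isZmodule.Build dim_group dg_addA dg_addC dg_add0 dg_addN.

(* L_* [f] = [L f]; in the situation considered here L f is continuous, and
   the class of L f only depends on the class of f. *)
Definition dg_transfer (u : dim_group) : dim_group :=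
  dg_class (to_cont_int (transfer (repr u))).

Lemma dg_transferE (f : cont_int X) :
  (forall g : cont_int X, transfer g \in @continuous_int X) ->
  dg_transfer (dg_class f) = dg_class (to_cont_int (transfer f)).
Proof.
move=> cL; apply/dg_classP; have [k fk] := dg_reprP f; exists k.
by rewrite /to_cont_int !insubdK// -!iterSr !iterS fk.
Qed.

(* The Z[t, t^-1]-submodules of the dimension group, when L_* is bijective and
   t acts as L_*: subgroups N with t N `<=` N and t^-1 N `<=` N.  The latter
   set is the preimage of N under L_*. *)
Definition laurent_submodule (N : set dim_group) : Prop :=
  [/\ N 0, forall u v, N u -> N v -> N (u - v),
      dg_transfer @` N `<=` N & dg_transfer @^-1` N `<=` N].

Definition laurent_span (J : set dim_group) : set dim_group :=
  smallest laurent_submodule J.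

End DimensionGroup.

Section IntervalClasses.
Variables (R : realType) (tau : R -> R) (C : set R).

Let X := disconnection (generalized_orbit tau C).

(* sigma is the local homeomorphism associated with tau and C: these two
   conditions determine it, since X_0 is dense in X. *)
Definition associated_map (sigma : X -> X) : Prop :=
  continuous sigma /\
  forall x : X, orbit_complement tau C (collapse x) ->
    collapse (sigma x) = tau (collapse x).

Variable sigma : X -> X.

(* The class of the characteristic function of [c^+, d^-]_X, for c < d. *)
Definition ordered_interval_class (c d : R) : dim_group sigma :=
  dg_class sigma (to_cont_int (\1_`[disc_plus _ c, disc_minus _ d])).

(* I(c, d) in the dimension group, for c and d in the generalized orbit. *)
Definition interval_class (c d : R) : dim_group sigma :=
  if c < d then ordered_interval_class c d
  else if d < c then ordered_interval_class d c
  else 0.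

End IntervalClasses.

(* Main.v *)
(**
  Write [I1] for the generalized orbit.  On each interval [[a_i, a_(i+1)]] the
  map [sigma] restricts to a bijection from [I(c, d)] onto [I(T c, T d)], where
  [T] is the branch of [tau]; hence [L_* I(c, d) = I(T c, T d)] for [c, d] in
  [I1] and in the same interval.  Given a submodule [N], the relation
  "[I(c, d)] belongs to [N]" is an equivalence relation on [I1], since
  [I(c, d)] is, up to sign, a difference of [I(0, d)] and [I(0, c)]; and, [N]
  being stable under [t] and [t^-1], two points of one interval are equivalent
  if and only if their images are.  If [N] contains the given generators, then
  all [a_i] and [M] are equivalent ([J1]), all one-sided limits at the [a_i] are
  equivalent to each other ([J2]), and [M] links the two classes.  So the class
  of [0] contains [C] and is closed under [hat tau] and its inverse: it is [I1].
  Finally the functions [I(0, d)], [d] in [I1], generate [C(X, Z)].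

  Countability of [I1] makes its complement dense, which is what determines
  [sigma] from its values over that complement.
*)

Require Import Defs.
From HB Require Import structures.
From mathcomp Require Import all_boot all_order all_algebra finmap.
From mathcomp Require Import all_classical all_reals topology normedtype.
From mathcomp Require Import numfun realfun lebesgue_measure lra.

Set Implicit Arguments.
Unset Strict Implicit.
Unset Printing Implicit Defensive.

Import Order.TTheory GRing.Theory Num.Theory.
Import numFieldNormedType.Exports.

Local Open Scope classical_set_scope.
Local Open Scope ring_scope.

(** * The disconnection as an ordered space *)

Section DisconnectionTheory.
Variables (R : realType) (D : set R).
Local Notation X := (disconnection D).
Implicit Types (x y c d : R) (p q : X).

Lemma collapse_itv p : 0 <= collapse p <= 1.
Proof. by have /andP[] := disc_valP p. Qed.

Lemma disc_val_minus x : 0 <= x <= 1 -> disc_val (disc_minus D x) = (x, false).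
Proof.
by move=> x01; rewrite /disc_minus insubdK// unfold_in /in_disconnection/= x01.
Qed.

Lemma disc_val_plus x : 0 <= x <= 1 ->
  disc_val (disc_plus D x) = (x, split_point D x).
Proof.
move=> x01; rewrite /disc_plus insubdK// unfold_in /in_disconnection/= x01/=.
exact: implybb.
Qed.

Lemma collapse_minus x : 0 <= x <= 1 -> collapse (disc_minus D x) = x.
Proof. by move=> x01; rewrite /collapse disc_val_minus. Qed.

Lemma collapse_plus x : 0 <= x <= 1 -> collapse (disc_plus D x) = x.
Proof. by move=> x01; rewrite /collapse disc_val_plus. Qed.

Lemma disc_leE p q : (p <= q)%O =
  (collapse p < collapse q) ||
  ((collapse p == collapse q) && ((disc_val p).2 ==> (disc_val q).2)).
Proof.
rewrite leEsub /= Order.ProdLexiOrder.leEprodlexi /collapse /=.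
by case: ltgtP => //= _; case: (disc_val p).2; case: (disc_val q).2.
Qed.

Lemma disc_lt p q : collapse p < collapse q -> (p < q)%O.
Proof. by move=> pq; rewrite ltNge disc_leE negb_or lt_gtF//= gt_eqF. Qed.

(** When [c] is not split, [disc_plus D c] is the only point over [c], so any [p] over [c]
    qualifies; hence the implication in place of a plain Boolean. *)
Lemma plus_le c p : 0 <= c <= 1 -> (disc_plus D c <= p)%O =
  (c < collapse p) || ((c == collapse p) && (split_point D c ==> (disc_val p).2)).
Proof. by move=> c01; rewrite disc_leE collapse_plus// disc_val_plus. Qed.

Lemma le_minus d p : 0 <= d <= 1 -> (p <= disc_minus D d)%O =
  (collapse p < d) || ((collapse p == d) && ~~ (disc_val p).2).
Proof.
by move=> d01; rewrite disc_leE collapse_minus// disc_val_minus//= implybF.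
Qed.

Lemma disc_itv_sub u c d v p : 0 <= u <= c -> c <= d -> d <= v <= 1 ->
  p \in `[disc_plus D c, disc_minus D d] ->
  p \in `[disc_plus D u, disc_minus D v].
Proof.
move=> /andP[u0 uc] cd /andP[dv v1].
have [c0 d0] : 0 <= c /\ 0 <= d by split; lra.
have [c1 d1] : c <= 1 /\ d <= 1 by split; lra.
have [u1 v0] : u <= 1 /\ 0 <= v by split; lra.
rewrite !in_itv/= => /andP[cp pd]; apply/andP; split.
  apply: le_trans cp; rewrite disc_leE !collapse_plus ?u0 ?c0//.
  rewrite !disc_val_plus ?u0 ?c0//=.
  move: uc; rewrite le_eqVlt => /orP[/eqP ->|->//].
  by rewrite eqxx implybb orbT.
apply: le_trans pd _.
rewrite disc_leE !collapse_minus ?d0 ?v0// !disc_val_minus ?d0 ?v0//= andbT.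
by rewrite orbC -le_eqVlt.
Qed.

Lemma disc_eq p q : collapse p = collapse q -> (disc_val p).2 = (disc_val q).2 ->
  p = q.
Proof.
rewrite /collapse => e1 e2; apply: val_inj => /=.
by case: (disc_val p) (disc_val q) e1 e2 => ? ? [? ?] /= -> ->.
Qed.

Lemma disc_split p : (disc_val p).2 -> split_point D (collapse p).
Proof. by have /andP[_ /implyP] := disc_valP p. Qed.

Lemma disc_eq_nsplit p q : collapse p = collapse q ->
  ~~ split_point D (collapse p) -> p = q.
Proof.
move=> e ns; apply: disc_eq => //.
rewrite (negbTE (contraNN (@disc_split p) ns)).
by rewrite e in ns; rewrite (negbTE (contraNN (@disc_split q) ns)).
Qed.

Lemma disc_minusP p : ~~ (disc_val p).2 -> p = disc_minus D (collapse p).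
Proof.
move=> np; have := collapse_itv p => p01.
by apply: disc_eq; rewrite ?collapse_minus ?disc_val_minus//= (negbTE np).
Qed.

Lemma disc_plusP p : (disc_val p).2 = split_point D (collapse p) ->
  p = disc_plus D (collapse p).
Proof.
move=> np; have := collapse_itv p => p01.
by apply: disc_eq; rewrite ?collapse_plus ?disc_val_plus//= (negbTE np).
Qed.

Lemma disc_plus_eq_minus x : ~~ split_point D x -> disc_plus D x = disc_minus D x.
Proof. by move=> ns; rewrite /disc_plus (negbTE ns). Qed.

Lemma disc_minus_gt q x : 0 <= x <= 1 ->
  (q < disc_minus D x)%O = (collapse q < x).
Proof.
move=> x01; rewrite lt_neqAle le_minus//.
case: ltgtP => [qx|_|qx]; rewrite ?andbT ?andbF//=.
  by apply/eqP => qE; rewrite qE collapse_minus// ltxx in qx.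
apply/negbTE; apply/negP => /andP[/negP + /disc_minusP qE]; apply.
by apply/eqP; rewrite qE qx.
Qed.

Lemma disc_plus_lt q x : 0 <= x <= 1 ->
  (disc_plus D x < q)%O = (x < collapse q).
Proof.
move=> x01; rewrite lt_neqAle plus_le//.
case: ltgtP => [qx|_|qx]; rewrite ?andbT ?andbF//=.
  by apply/eqP => qE; rewrite -qE collapse_plus// ltxx in qx.
apply/negbTE; apply/negP => /andP[/negP + /implyP h]; apply; apply/eqP.
rewrite [q]disc_plusP -?qx//; apply/idP/idP => // /disc_split.
by rewrite -qx.
Qed.

(** Among the points over [x], [disc_minus D x] is the smallest, so only the left end of a basic
    interval around it restricts the points over smaller reals. That end collapses to some [y < x];
    an interval unbounded on the left gives [y = 0]. *)
Lemma nbhs_disc_minus x (U : set X) : 0 < x <= 1 -> nbhs (disc_minus D x) U ->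
  exists2 y, 0 <= y < x & forall p, y < collapse p < x -> U p.
Proof.
move=> /andP[x0 x1]; have x01 : 0 <= x <= 1 by rewrite ltW.
rewrite itv_nbhsE => -[[l r] [lro]].
rewrite itv_boundlr => /andP[/= lx xr] IU.
have rP p : collapse p < x -> (BRight p <= r)%O.
  by move=> px; apply: le_trans xr; rewrite bnd_simp ltW// disc_minus_gt.
case: l lro lx IU => [b q /itv_open_ends_lside ->|b /itv_open_ends_linfty ->] lx IU.
- exists (collapse q).
    have /andP[-> _] /= := collapse_itv q.
    by rewrite -disc_minus_gt// -bnd_simp.
  move=> p /andP[qp px]; apply: IU; rewrite /= itv_boundlr rP// bnd_simp andbT.
  exact: disc_lt.
- exists 0; first by rewrite lexx.
  by move=> p /andP[_ px]; apply: IU; rewrite /= itv_boundlr rP.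
Qed.

Lemma nbhs_disc_plus x (U : set X) : 0 <= x < 1 -> nbhs (disc_plus D x) U ->
  exists2 y, x < y <= 1 & forall p, x < collapse p < y -> U p.
Proof.
move=> /andP[x0 x1]; have x01 : 0 <= x <= 1 by rewrite x0 ltW.
rewrite itv_nbhsE => -[[l r] [lro]].
rewrite itv_boundlr => /andP[/= lx xr] IU.
have lP p : x < collapse p -> (l <= BLeft p)%O.
  by move=> px; apply: le_trans lx _; rewrite bnd_simp ltW// disc_plus_lt.
case: r lro xr IU => [b q /itv_open_ends_rside ->|b /itv_open_ends_rinfty ->] xr IU.
- exists (collapse q).
    have /andP[_ ->] /= := collapse_itv q.
    by rewrite andbT -disc_plus_lt// -bnd_simp.
  move=> p /andP[xp pq]; apply: IU; rewrite /= itv_boundlr lP//= bnd_simp.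
  exact: disc_lt.
- exists 1; first by rewrite lexx andbT.
  by move=> p /andP[px _]; apply: IU; rewrite /= itv_boundlr lP.
Qed.

(** A point of the interval is either the lower point over some [x > c], approached by points over
    [Z] from the left, or the upper point over some [x < d], approached from the right. *)
Lemma disc_itv_dense (Z : set R) c d p (U : set X) :
  (forall x y, 0 <= x -> x < y -> y <= 1 -> exists2 r, x < r < y & Z r) ->
  0 <= c -> c < d -> d <= 1 -> p \in `[disc_plus D c, disc_minus D d] ->
  nbhs p U -> exists2 q, U q & c < collapse q < d /\ Z (collapse q).
Proof.
move=> dZ c0 cd d1; have c01 : 0 <= c <= 1 by rewrite c0 ltW// (lt_le_trans cd).
have d01 : 0 <= d <= 1 by rewrite d1 ltW// (le_lt_trans c0).
rewrite in_itv/= plus_le// le_minus// => /andP[cp pd] pU.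
have Zq r : c < r < d -> Z r -> (forall q, collapse q = r -> U q) ->
    exists2 q, U q & c < collapse q < d /\ Z (collapse q).
  move=> /andP[cr rd] Zr Ur.
  have r01 : 0 <= r <= 1 by rewrite (le_trans c0 (ltW cr)) (le_trans (ltW rd)).
  exists (disc_minus D r); first by apply: Ur; rewrite collapse_minus.
  by rewrite collapse_minus// cr.
have [/andP[cx /disc_minusP pE]|npm] :=
    boolP ((c < collapse p) && ~~ (disc_val p).2).
  have xd : collapse p <= d by case/orP: pd => [/ltW//|/andP[/eqP->]].
  have x1 : 0 < collapse p <= 1 by rewrite (le_lt_trans c0)//= (le_trans xd).
  rewrite pE in pU; have [y /andP[y0 yx] yU] := nbhs_disc_minus x1 pU.
  have ycx : Num.max y c < collapse p by rewrite gt_max yx cx.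
  have [||r /andP[]] := dZ (Num.max y c) (collapse p) _ ycx.
  - by rewrite le_max y0.
  - by case/andP: x1.
  rewrite gt_max => /andP[yr cr] rx Zr; apply: (Zq r) => //.
    by rewrite cr (lt_le_trans rx).
  by move=> q qr; apply: yU; rewrite qr yr.
have [p2 xd] : (disc_val p).2 = split_point D (collapse p) /\ collapse p < d.
  case/orP: cp => [cx|/andP[/eqP cx /implyP csp]].
    move: npm; rewrite cx/= negbK => p2; split; first by rewrite p2 disc_split.
    by move: pd; rewrite p2 andbF orbF.
  rewrite -cx; split=> //; apply/idP/idP => [|/csp//].
  by move=> /disc_split; rewrite -cx.
have cx : c <= collapse p by case/orP: cp => [/ltW//|/andP[/eqP->]].
have x1 : 0 <= collapse p < 1 by rewrite (le_trans c0)//= (lt_le_trans xd).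
rewrite (disc_plusP p2) in pU; have [y /andP[xy y1] yU] := nbhs_disc_plus x1 pU.
have xyd : collapse p < Num.min y d by rewrite lt_min xy xd.
have [||r /andP[]] := dZ (collapse p) (Num.min y d) _ xyd.
- by case/andP: x1.
- by rewrite ge_min y1.
rewrite lt_min => xr /andP[ry rd] Zr; apply: (Zq r) => //.
  by rewrite rd (le_lt_trans cx).
by move=> q qr; apply: yU; rewrite qr ry andbT.
Qed.

End DisconnectionTheory.

(** * Generators of C(X, Z) *)

Lemma cont_intP (X : topologicalType) (f : X -> int) :
  f \in @continuous_int X <-> forall x, \forall y \near x, f y = f x.
Proof.
pose g : X -> discrete_topology int := f.
split => [/asboolP cf x|cf].
  by have /discrete_cvg : g @ x --> g x by exact: cf.
apply/asboolP => x; suff : g @ x --> g x by [].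
by apply/discrete_cvg; exact: cf.
Qed.

(** Real induction: the supremum of the points of [[0, 1]] satisfying [P] satisfies [P] by the
    second hypothesis, and cannot be less than 1 by the third. [P] need not hold on an initial
    segment, so the second hypothesis only offers points of [P] arbitrarily close to [x]. *)
Lemma unit_itv_ind (R : realType) (P : R -> Prop) :
  P 0 ->
  (forall x, 0 < x <= 1 ->
    (forall y, y < x -> exists z, [/\ 0 <= z, y < z < x & P z]) -> P x) ->
  (forall x, 0 <= x < 1 -> P x -> exists2 z, x < z <= 1 & P z) ->
  P 1.
Proof.
move=> P0 Pl Pr; pose S := [set x : R | 0 <= x <= 1 /\ P x].
have S0 : S 0 by rewrite /S/= lexx ler01.
have ubS : ubound S 1 by move=> x [/andP[]].
have supS : has_sup S by split; [exists 0|exists 1].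
have s0 : 0 <= sup S by apply: ub_le_sup => //; exists 1.
have s1 : sup S <= 1 by apply: ge_sup => //; exists 0.
have Ps : P (sup S).
  have [<-//|ns0] := eqVneq 0 (sup S).
  apply: contrapT => nPs; apply: (nPs); apply: Pl => [|y ys].
    by rewrite lt_neqAle ns0 s0.
  have [z Sz yz] := @sup_adherent _ S (sup S - y) (ltac:(by rewrite subr_gt0)) supS.
  rewrite subKr in yz; exists z; have [/andP[z0 _] Pz] := Sz; split => //.
  rewrite yz/= lt_neqAle ub_le_sup ?andbT//; last by exists 1.
  by apply/eqP => zs; move: Pz; rewrite zs.
have [s1'|] := ltP (sup S) 1; last by move=> /(conj s1)/andP/le_anti <-.
have [|z /andP[sz z1] Pz] := Pr _ _ Ps; first by rewrite s0.
suff : z <= sup S by rewrite leNgt sz.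
by apply: ub_le_sup; [exists 1|split => //; rewrite z1 (le_trans s0)// ltW].
Qed.

Section Below.
Variables (R : realType) (D : set R).
Local Notation X := (disconnection D).
Implicit Types (x y c d : R) (p q : X).

(* [below 0 = 0] although [disc_minus D 0] is a point of the disconnection, so
   that [below d - below c] is the indicator of [c^+, d^-]_X also for [c = 0]. *)
Definition below x : X -> int :=
  fun p => ((0 < x) && (p <= disc_minus D x)%O)%:R.

Lemma disc_min p : (disc_minus D 0 <= p)%O.
Proof.
rewrite disc_leE collapse_minus ?disc_val_minus ?lexx ?ler01//= andbT.
by rewrite orbC -le_eqVlt; case/andP: (collapse_itv p).
Qed.

Lemma disc_max p : (p <= disc_minus D 1)%O.
Proof.
rewrite le_minus ?ler01 ?lexx//; have /andP[_ p1] := collapse_itv p.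
move: p1; rewrite le_eqVlt orbC => /orP[->//|/eqP p1]; rewrite p1 eqxx/=.
apply/orP; right; apply/negP => /disc_split; rewrite p1 /split_point eqxx.
by rewrite !andbF.
Qed.

(** The two points over a split [x] are consecutive in the order; this gap is what makes initial
    segments clopen. *)
Lemma plus_le_Nminus x p : 0 <= x <= 1 -> split_point D x ->
  (disc_plus D x <= p)%O = ~~ (p <= disc_minus D x)%O.
Proof.
move=> x01 sx; rewrite plus_le// le_minus// sx.
by case: ltgtP => //= _; rewrite negbK.
Qed.

Lemma below0 : below 0 = 0.
Proof. by apply/funext => p; rewrite /below ltxx. Qed.

Lemma below1 p : below 1 p = 1.
Proof. by rewrite /below ltr01 disc_max. Qed.

(** At a split point the initial segment ending at x^- is the open ray below x^+, and its complement
    is the open ray above x^-. The end points 0 and 1 are never split and give constant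
    functions. *)
Lemma below_cont x : 0 <= x <= 1 -> D x -> below x \in @continuous_int X.
Proof.
move=> x01 Dx; have [->|x0] := eqVneq x 0.
  by rewrite below0; exact: rpred0.
have [->|x1] := eqVneq x 1.
  by apply/cont_intP => p; near=> q; rewrite !below1.
have sx : split_point D x by rewrite /split_point x0 x1 !andbT; exact/mem_set.
apply/cont_intP => p; rewrite /below.
have [px|xp] := leP p (disc_minus D x).
  have : nbhs p [set` `]-oo, disc_plus D x[].
    apply: open_nbhs_nbhs; split; [exact: lray_open|].
    by rewrite /= in_itv/= ltNge plus_le_Nminus// px.
  apply: filterS => q; rewrite /= in_itv/= ltNge plus_le_Nminus// negbK => qx.
  by rewrite qx.
have : nbhs p [set` `]disc_minus D x, +oo[].
  by apply: open_nbhs_nbhs; split; [exact: rray_open|]; rewrite /= in_itv/= xp.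
by apply: filterS => q; rewrite /= in_itv/= andbT ltNge => /negbTE ->.
Unshelve. all: by end_near. Qed.

Lemma indic_itvE c d : D c -> 0 <= c -> c < d -> d <= 1 ->
  \1_`[disc_plus D c, disc_minus D d] = below d - below c.
Proof.
move=> Dc c0 cd d1; apply/funext => p.
have c01 : 0 <= c <= 1 by rewrite c0 ltW// (lt_le_trans cd).
have d01 : 0 <= d <= 1 by rewrite d1 ltW// (le_lt_trans c0).
transitivity (below d p - below c p); last by [].
rewrite indicE mem_setE in_itv/= /below (le_lt_trans c0 cd)/=.
have [->|cn0] := eqVneq c 0.
  rewrite ltxx subr0 plus_le ?lexx ?ler01// /split_point eqxx/= andbF/= andbT.
  by rewrite orbC -le_eqVlt; have /andP[->] := collapse_itv p.
have sc : split_point D c.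
  by rewrite /split_point cn0 lt_eqF ?(lt_le_trans cd)// !andbT; exact/mem_set.
rewrite plus_le_Nminus// lt_neqAle eq_sym cn0 c0/=.
have [pc|] /= := boolP (p <= disc_minus D c)%O; last by rewrite subr0.
have -> : (p <= disc_minus D d)%O; last by rewrite subrr.
by rewrite (le_trans pc)// ltW// disc_minus_gt// collapse_minus.
Qed.

(* [f] is matched on an initial segment [0, x^-]_X by an element of [G] that is
   constant from x^- on; this segment is enlarged up to [x = 1]. *)
Lemma cont_int_ind (G : set (X -> int)) :
  D 1 -> G 0 -> (forall f g, G f -> G g -> G (f - g)) ->
  (forall x, 0 <= x <= 1 -> D x -> G (below x)) ->
  forall f, f \in @continuous_int X -> G f.
Proof.
move=> D1 G0 GB Gb f /cont_intP cf.
have GN g : G g -> G (- g) by move=> Gg; rewrite -sub0r; exact: GB.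
have GD g h : G g -> G h -> G (g + h).
  by move=> Gg /GN; rewrite -{2}[h]opprK; exact: GB.
have GMn g n : G g -> G (g *+ n).
  by move=> Gg; elim: n => [|n IHn]; rewrite ?mulr0n// mulrS; exact: GD.
have GM g (k : int) : G g -> G (g *~ k).
  by case: k => k Gg; [exact: GMn|apply: GN; exact: GMn].
have funM (g : X -> int) (k : int) p : (g *~ k) p = g p * k.
  have nE n : (g *+ n) p = g p *+ n.
    by elim: n => [|n IHn]; rewrite ?mulr0n// !mulrS -IHn.
  by rewrite -mulrzz; case: k => k; [exact: nE|congr (- _); exact: nE].
have Gb1 : G (below 1) by apply: Gb => //; rewrite ler01 lexx.
suff [g Gg [fg _]] : exists2 g, G g &
    (forall p, (p <= disc_minus D 1)%O -> f p = g p) /\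
    forall p, (disc_minus D 1 <= p)%O -> g p = g (disc_minus D 1).
  by rewrite (_ : f = g)//; apply/funext => p; apply/fg/disc_max.
apply: (@unit_itv_ind _ (fun x => exists2 g, G g &
    (forall p, (p <= disc_minus D x)%O -> f p = g p) /\
    forall p, (disc_minus D x <= p)%O -> g p = g (disc_minus D x))).
- exists (below 1 *~ f (disc_minus D 0)); first exact: GM.
  split => p; rewrite !funM !below1 !mul1r// => p0.
  by congr f; apply: le_anti; rewrite p0 disc_min.
(* Over the reals between [y] and [x], [f] already has its value at x^-, and [g] is constant from
   z^- on, so the [g] obtained for [z] still serves for [x]. *)
- move=> x x01 xl; have x01' : 0 <= x <= 1.
    by case/andP: x01 => /ltW -> ->.
  have [y /andP[y0 yx] yU] := nbhs_disc_minus x01 (cf (disc_minus D x)).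
  have [z [z0 /andP[yz zx] [g Gg [fg gz]]]] := xl _ yx.
  have z01 : 0 <= z <= 1.
    by rewrite z0 ltW// (lt_le_trans zx)//; case/andP: x01.
  have zx' : (disc_minus D z <= disc_minus D x)%O.
    by rewrite ltW// disc_minus_gt// collapse_minus.
  exists g => //; split => p; last first.
    by move=> xp; rewrite gz ?(le_trans zx')// [RHS]gz.
  have [pz _|zp px] := leP p (disc_minus D z); first exact: fg.
  rewrite gz; last exact: ltW.
  rewrite -fg// (yU (disc_minus D z)) ?collapse_minus ?yz//.
  have [pxl|xp] := ltP (collapse p) x.
    apply: yU; rewrite pxl andbT (lt_le_trans yz)//.
    by move: (ltW zp); rewrite disc_leE collapse_minus// => /orP[/ltW|/andP[/eqP->]].
  congr f; apply: le_anti; rewrite px/=.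
  by rewrite disc_leE collapse_minus// disc_val_minus//= andbT orbC -le_eqVlt.
- move=> x x01 [h Gh [fh hx]]; have x01' : 0 <= x <= 1.
    by case/andP: x01 => -> /ltW.
  (* The gap from x^- to x^+ is crossed first, since [f] may jump there; if [x] is not split there
     is no gap and [h] is kept. *)
  have [g Gg [fg gx]] : exists2 g, G g &
      (forall p, (p <= disc_plus D x)%O -> f p = g p) /\
      forall p, (disc_plus D x <= p)%O -> g p = g (disc_plus D x).
    have [sx|/disc_plus_eq_minus ->] := boolP (split_point D x); last first.
      by exists h.
    have [x0 Dx] : 0 < x /\ D x.
      case/and3P: sx => /set_mem Dx x0 _; split => //.
      by rewrite lt_neqAle eq_sym x0; case/andP: x01.
    (* [k] is the error of [h] at x^+. Adding [k] times the indicator of the points above x^-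
       corrects it and leaves the values up to x^- unchanged. *)
    pose k := f (disc_plus D x) - h (disc_plus D x).
    pose g := h + (below 1 - below x) *~ k.
    have gE p : g p = h p + (~~ (p <= disc_minus D x)%O)%:R * k.
      rewrite [LHS]/GRing.add/= funM; congr (_ + _ * k).
      transitivity (below 1 p - below x p); first by [].
      rewrite below1 /below x0/=.
      by case: (p <= _)%O; rewrite /= ?subrr ?subr0.
    exists g; first by apply: GD => //; apply: GM; apply: GB => //; exact: Gb.
    split => p; rewrite !gE -!plus_le_Nminus// ?lexx ?mul1r.
      rewrite le_eqVlt => /orP[/eqP ->|]; first by rewrite lexx mul1r /k addrC subrK.
      rewrite ltNge => px; rewrite (negbTE px) mul0r addr0; apply: fh.
      by move: px; rewrite plus_le_Nminus// negbK.
    move=> xp; rewrite xp mul1r; congr (_ + _); rewrite hx ?[RHS]hx//.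
      by rewrite ltW// ltNge -plus_le_Nminus.
    by rewrite ltW// ltNge -plus_le_Nminus.
  have [y /andP[xy y1] yU] := nbhs_disc_plus x01 (cf (disc_plus D x)).
  (* The next point must be strictly less than [y], so that every point up to z^- lies over a real
     where [f] is known to be constant. *)
  have [xz zy] : x < (x + y) / 2 /\ (x + y) / 2 < y by split; lra.
  set z := (x + y) / 2 in xz zy *.
  have z01 : 0 <= z <= 1.
    by rewrite (le_trans _ (ltW xz))/= ?(le_trans (ltW zy))//; case/andP: x01.
  have xz' : (disc_plus D x <= disc_minus D z)%O.
    by rewrite ltW// disc_plus_lt// collapse_minus.
  exists z; first by rewrite xz (le_trans (ltW zy)).
  exists g => //; split => p; last first.
    by move=> zp; rewrite gx ?(le_trans xz')// [RHS]gx.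
  have [px _|xp pz] := leP p (disc_plus D x); first exact: fg.
  rewrite gx; last exact: ltW.
  rewrite -fg//; apply: yU; move: xp; rewrite disc_plus_lt// => ->/=.
  apply: le_lt_trans zy.
  by move: pz; rewrite le_minus// => /orP[/ltW|/andP[/eqP->]].
Qed.

End Below.

Arguments below {R} D x p.

(** * The lift of one monotonic branch *)

Section Branch.
Variables (R : realType) (D : set R).
Local Notation X := (disconnection D).
Variables (sigma : X -> X) (T : R -> R) (u v : R).
Implicit Types (c d e x y z w : R) (p q : X).

(** [T] is one branch on [[u, v]], described by monotonicity and surjectivity alone. [sigmaT] is
    assumed only off [D]; density of the complement and continuity of [sigma] extend it to all
    points of the piece. *)
Hypothesis D_codense :
  forall x y, 0 <= x -> x < y -> y <= 1 -> exists2 r, x < r < y & ~ D r.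
Hypothesis sigma_cont : continuous sigma.
Hypotheses (u0 : 0 <= u) (uv : u < v) (v1 : v <= 1).
Hypothesis T_itv : forall x, u <= x <= v -> 0 <= T x <= 1.
Hypothesis T_mono : {in `[u, v] &, {mono T : x y / x <= y}} \/
                    {in `[u, v] &, {mono T : x y /~ x <= y}}.
Hypothesis T_onto : forall w, Num.min (T u) (T v) <= w <= Num.max (T u) (T v) ->
  exists2 x, u <= x <= v & T x = w.
Hypothesis T_D : forall x, u < x < v -> D x <-> D (T x).
Hypothesis sigmaT : forall p, u < collapse p < v -> ~ D (collapse p) ->
  collapse (sigma p) = T (collapse p).

(** Independent of the order of [x] and [y], so that increasing and decreasing branches share their
    statements. *)
Definition hull x y : interval X :=
  `[disc_plus D (Num.min x y), disc_minus D (Num.max x y)].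

Lemma hullC x y : hull x y = hull y x.
Proof. by rewrite /hull minC maxC. Qed.

Lemma hull_collapse x y p : 0 <= x <= 1 -> 0 <= y <= 1 -> p \in hull x y ->
  Num.min x y <= collapse p <= Num.max x y.
Proof.
move=> x01 y01; wlog xy : x y x01 y01 / x <= y.
  move=> wl; case/orP: (le_total x y) => [xy|yx]; first exact: wl.
  by rewrite hullC minC maxC; exact: wl.
rewrite /hull min_l// max_r// in_itv/= plus_le// le_minus// => /andP[xp py].
apply/andP; split; first by case/orP: xp => [/ltW//|/andP[/eqP->]].
by case/orP: py => [/ltW//|/andP[/eqP->]].
Qed.

Lemma collapse_hull x y p : 0 <= x <= 1 -> 0 <= y <= 1 ->
  Num.min x y < collapse p < Num.max x y -> p \in hull x y.
Proof.
move=> x01 y01 /andP[xp py]; rewrite in_itv/= plus_le ?le_minus ?xp ?py//.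
  by rewrite /Num.max; case: ifP.
by rewrite /Num.min; case: ifP.
Qed.

(** Only one point over the end [x] lies in the hull: the upper one if [x < y], the lower one if
    [y < x]. *)
Lemma hull_end_inj x y p q : 0 <= x <= 1 -> 0 <= y <= 1 -> x != y ->
  p \in hull x y -> q \in hull x y -> collapse p = x -> collapse q = x -> p = q.
Proof.
move=> x01 y01 xy ph qh px qx; apply: disc_eq; first by rewrite px.
move: xy ph qh; rewrite neq_lt => /orP[xy|yx].
  have xE r : r \in hull x y -> collapse r = x ->
      (disc_val r).2 = split_point D x.
    rewrite /hull min_l ?(ltW xy)// max_r ?(ltW xy)// in_itv/= plus_le//.
    move=> /andP[+ _] rx; rewrite rx ltxx eqxx/= => /implyP h.
    by apply/idP/idP => // /disc_split; rewrite rx.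
  by move=> /xE-/(_ px) -> /xE-/(_ qx) ->.
have xE r : r \in hull x y -> collapse r = x -> (disc_val r).2 = false.
  rewrite /hull min_r ?(ltW yx)// max_l ?(ltW yx)// in_itv/= le_minus//.
  by move=> /andP[_ +] rx; rewrite rx ltxx eqxx/= => /negbTE.
by move=> /xE-/(_ px) -> /xE-/(_ qx) ->.
Qed.

Let uv01 x : u <= x <= v -> 0 <= x <= 1.
Proof. by move=> /andP[ux xv]; rewrite (le_trans u0)// (le_trans xv). Qed.

Lemma T_inj x y : u <= x <= v -> u <= y <= v -> T x = T y -> x = y.
Proof.
move=> xI yI xy; apply: le_anti.
by case: T_mono => m; rewrite -[x <= y]m -?[y <= x]m ?in_itv//= xy lexx.
Qed.

Lemma T_between c d x : u <= c <= v -> u <= d <= v -> c < x < d ->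
  Num.min (T c) (T d) < T x < Num.max (T c) (T d).
Proof.
move=> cI dI /andP[cx xd].
have xI : u <= x <= v.
  case/andP: cI dI => uc _ /andP[_ dv].
  by rewrite (le_trans uc (ltW cx)) (le_trans (ltW xd)).
rewrite gt_min lt_max; case: T_mono => m; rewrite !ltNge !m ?in_itv//= -!ltNge.
  by rewrite cx xd orbT.
by rewrite cx xd orbT.
Qed.

Lemma T_onto_itv c d w : u <= c <= v -> u <= d <= v -> c <= d ->
  Num.min (T c) (T d) <= w <= Num.max (T c) (T d) ->
  exists2 x, c <= x <= d & T x = w.
Proof.
move=> cI dI cd; have uI : u <= u <= v by rewrite lexx ltW.
have vI : u <= v <= v by rewrite lexx ltW.
have [[uc _] [_ dv]] := (andP cI, andP dI).
case: T_mono => m.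
  have mle x y : u <= x <= v -> u <= y <= v -> x <= y -> T x <= T y.
    by move=> xI yI; rewrite m ?in_itv.
  rewrite min_l ?max_r ?mle// => /andP[cw wd].
  have [|x xI xw] := T_onto (w := w).
    rewrite min_l ?max_r//; try exact: mle uI vI (ltW uv).
    by rewrite (le_trans _ cw) ?(le_trans wd)// mle.
  by exists x => //; rewrite -[c <= x]m -?[x <= d]m ?in_itv//= xw cw.
have mle x y : u <= x <= v -> u <= y <= v -> x <= y -> T y <= T x.
  by move=> xI yI; rewrite m ?in_itv.
rewrite min_r ?max_l ?mle// => /andP[dw wc].
have [|x xI xw] := T_onto (w := w).
  rewrite min_r ?max_l//; try exact: mle uI vI (ltW uv).
  by rewrite (le_trans _ dw) ?(le_trans wc)// mle.
by exists x => //; rewrite -[c <= x]m -?[x <= d]m ?in_itv//= xw wc.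
Qed.

(** Stands in for continuity of [T] at [x] from the side of [e]. If [y] were not [T x], the midpoint
    [w] of [y] and [T x] would be a value [T z'] with [z'] strictly between [e] and [x], and the
    hypothesis at [z'] would put [y] between [w] and [T x]. *)
Lemma T_squeeze e x y : u <= e <= v -> u <= x <= v -> e != x ->
  (forall z, Num.min e x < z < Num.max e x ->
     Num.min (T z) (T x) <= y <= Num.max (T z) (T x)) -> y = T x.
Proof.
move=> eI xI ex yz; apply: contrapT => /eqP yTx.
pose z := (e + x) / 2.
have zI : Num.min e x < z < Num.max e x.
  by move: ex; rewrite neq_lt /z => /orP[ex|xe];
    [rewrite min_l ?max_r ?(ltW ex)//|rewrite min_r ?max_l ?(ltW xe)//]; lra.
pose w := (y + T x) / 2.
have wI : Num.min (T z) (T x) <= w <= Num.max (T z) (T x).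
  by have := yz _ zI; rewrite /w !ge_min !le_max; lra.
have ordz z' : Num.min e x < z' < Num.max e x -> u <= z' <= v.
  by rewrite gt_min lt_max; lra.
have [z' z'I z'w] : exists2 z', Num.min z x <= z' <= Num.max z x & T z' = w.
  case/orP: (le_total z x) => [zx|xz].
    by rewrite min_l// max_r//; apply: T_onto_itv => //; exact: ordz.
  have [|z' ? ?] := @T_onto_itv x z w xI (ordz _ zI) xz.
    by rewrite minC maxC.
  by exists z' => //; rewrite min_r ?max_l.
have z'x : z' != x.
  by apply/eqP => z'x; move: z'w yTx; rewrite z'x /w neq_lt; lra.
have /yz : Num.min e x < z' < Num.max e x.
  move: zI z'I ex z'x; rewrite !neq_lt !gt_min !lt_max !ge_min !le_max; lra.
by rewrite z'w /w ge_min le_max; move: yTx; rewrite neq_lt; lra.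
Qed.

(* The points over the complement of [D] are dense in [c^+, d^-]_X, and their
   images lie in the closed interval [hull (T c) (T d)]. *)
Lemma sigma_hull c d p : u <= c -> c < d -> d <= v ->
  p \in `[disc_plus D c, disc_minus D d] -> sigma p \in hull (T c) (T d).
Proof.
move=> uc cd dv pI; apply: contrapT => nh.
have cI : u <= c <= v by rewrite uc (le_trans (ltW cd)).
have dI : u <= d <= v by rewrite dv (le_trans uc (ltW cd)).
have : nbhs p (sigma @^-1` (~` [set` hull (T c) (T d)])).
  apply: sigma_cont; apply: open_nbhs_nbhs; split => //.
  by apply: closed_openC; exact: itv_closed.
move=> /(disc_itv_dense D_codense (le_trans u0 uc) cd (le_trans dv v1) pI).
case=> q nq [cqd nDq]; apply: nq.
have quv : u < collapse q < v.
  by case/andP: cqd => cq qd; rewrite (le_lt_trans uc)// (lt_le_trans qd).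
by apply: collapse_hull; rewrite ?T_itv// sigmaT// T_between.
Qed.

(** A lower point over [x > u] lies in [[z^+, x^-]] for every [z] in []u, x[], so [sigma_hull]
    confines its image between [T z] and [T x], and [T_squeeze] concludes. Other points are upper
    points over some [x < v] and are squeezed from the right. *)
Lemma collapse_sigma p : p \in `[disc_plus D u, disc_minus D v] ->
  collapse (sigma p) = T (collapse p).
Proof.
have u01 : 0 <= u <= 1 by rewrite u0 (le_trans (ltW uv)).
have v01 : 0 <= v <= 1 by rewrite v1 (le_trans u0 (ltW uv)).
have uI : u <= u <= v by rewrite lexx ltW.
have vI : u <= v <= v by rewrite lexx ltW.
rewrite in_itv/= plus_le// le_minus// => /andP[up pv].
have pI : u <= collapse p <= v.
  apply/andP; split; first by case/orP: up => [/ltW//|/andP[/eqP->]].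
  by case/orP: pv => [/ltW//|/andP[/eqP->]].
have p01 := uv01 pI.
have [/andP[p2 ux]|nm] := boolP (~~ (disc_val p).2 && (u < collapse p)).
  apply: (T_squeeze uI pI); first by rewrite lt_eqF.
  rewrite min_l ?max_r ?(ltW ux)// => z /andP[uz zp].
  have zI : u <= z <= v by rewrite ltW// (le_trans (ltW zp))//; case/andP: pI.
  apply: hull_collapse; rewrite ?T_itv//; apply: sigma_hull => //.
  - exact: ltW.
  - by case/andP: pI.
  - by rewrite in_itv/= plus_le ?uv01// zp le_minus// eqxx p2 orbT.
have [p2 xv] : (disc_val p).2 = split_point D (collapse p) /\ collapse p < v.
  move: nm; rewrite negb_and negbK => /orP[p2|].
    by rewrite p2 disc_split//; move: pv; rewrite p2 andbF orbF.
  rewrite -leNgt => pu; have pE : collapse p = u.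
    by apply: le_anti; rewrite pu; case/andP: pI.
  move: up; rewrite pE ltxx eqxx/= => /implyP h; split=> //.
  by apply/idP/idP => // /disc_split; rewrite pE.
apply: (T_squeeze vI pI); first by rewrite gt_eqF.
rewrite min_r ?max_l ?(ltW xv)// => z /andP[pz zv].
have zI : u <= z <= v by rewrite (ltW zv) (le_trans _ (ltW pz))//; case/andP: pI.
rewrite minC maxC; apply: hull_collapse; rewrite ?T_itv//; apply: sigma_hull => //.
- by case/andP: pI.
- exact: ltW.
- by rewrite in_itv/= plus_le// eqxx p2 implybb orbT le_minus ?uv01// pz.
Qed.

(** [T x] lies strictly between [T u] and [T v], hence is neither 0 nor 1. *)
Lemma split_T x : u < x < v -> split_point D x -> split_point D (T x).
Proof.
move=> /andP[ux xv] /and3P[/set_mem Dx _ _].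
have uI : u <= u <= v by rewrite lexx ltW.
have vI : u <= v <= v by rewrite lexx ltW.
have /andP[mT TM] := T_between uI vI (introT andP (conj ux xv)).
have /andP[Tu0 Tu1] := T_itv uI; have /andP[Tv0 Tv1] := T_itv vI.
apply/and3P; split; first by apply/mem_set/(T_D (introT andP (conj ux xv)))/Dx.
  by rewrite gt_eqF// (le_lt_trans _ mT)// le_min Tu0.
by rewrite lt_eqF// (lt_le_trans TM)// ge_max Tu1.
Qed.

(** Since [T] is injective, only the two points over one split [x] could be identified. Their images
    lie in the hulls of [T u], [T x] and of [T x], [T v], which are disjoint because [T x] is split
    as well. *)
Lemma sigma_inj p q : p \in `[disc_plus D u, disc_minus D v] ->
  q \in `[disc_plus D u, disc_minus D v] -> sigma p = sigma q -> p = q.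
Proof.
have u01 : 0 <= u <= 1 by rewrite u0 (le_trans (ltW uv)).
have v01 : 0 <= v <= 1 by rewrite v1 (le_trans u0 (ltW uv)).
have uI : u <= u <= v by rewrite lexx ltW.
have vI : u <= v <= v by rewrite lexx ltW.
have clI r : r \in `[disc_plus D u, disc_minus D v] -> u <= collapse r <= v.
  rewrite in_itv/= plus_le// le_minus// => /andP[up pv].
  apply/andP; split; first by case/orP: up => [/ltW//|/andP[/eqP->]].
  by case/orP: pv => [/ltW//|/andP[/eqP->]].
move=> pI qI spq.
have pqE : collapse p = collapse q.
  by apply: T_inj; rewrite ?clI// -!collapse_sigma// spq.
apply: disc_eq => //; apply: contrapT => /eqP.
wlog p2 : p q pI qI spq pqE / ~~ (disc_val p).2.
  move=> wl ne; have [p2|p2] := boolP (disc_val p).2; last exact: (wl p q).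
  have q2 : ~~ (disc_val q).2 by apply: contra_neqN ne => q2; rewrite p2 q2.
  by apply: (wl q p) => //; rewrite eq_sym.
rewrite (negbTE p2) eq_sym eqbF_neg negbK => q2.
have sx := disc_split q2; have := qI; have := pI.
rewrite !in_itv/= !plus_le// !le_minus// q2 andbF orbF => /andP[up _] /andP[_ xv].
have {up} ux : u < collapse q.
  rewrite -pqE; case/orP: up => // /andP[/eqP uE]; rewrite (negbTE p2) implybF.
  by rewrite uE pqE sx.
set x := collapse q in pqE sx ux xv *.
have xI : u <= x <= v by rewrite !ltW.
have x01 := uv01 xI.
have sTx : split_point D (T x) by apply: split_T => //; rewrite ux.
have h1 : sigma p \in hull (T u) (T x).
  apply: (sigma_hull (lexx u) ux (ltW xv)).
  by rewrite in_itv/= plus_le// pqE ux le_minus// pqE eqxx p2 orbT.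
have h2 : sigma q \in hull (T x) (T v).
  apply: (sigma_hull (ltW ux) xv (lexx v)).
  by rewrite in_itv/= plus_le// eqxx q2 implybT orbT/= le_minus// xv.
have := T_between uI vI (introT andP (conj ux xv)).
rewrite gt_min lt_max => /andP[uxv xuv].
move: h1 h2; rewrite spq /hull; have := T_itv xI; set y := T x => y01.
have pm r : (disc_plus D y <= r)%O -> (r <= disc_minus D y)%O -> False.
  by rewrite plus_le_Nminus// => /negP.
case/orP: (le_total (T u) y) => [uy|yu].
  have yv : y <= T v by move: xuv; rewrite ltNge uy/= => /ltW.
  rewrite min_l// max_r// min_l// !in_itv/= => /andP[_ h1] /andP[h2 _].
  exact: pm h2 h1.
have vy : T v <= y by move: uxv; rewrite ltNge yu/= => /ltW.
rewrite min_r// max_l// max_l// !in_itv/= => /andP[h1 _] /andP[_ h2].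
exact: pm h1 h2.
Qed.

Lemma sigma_itv_image c d : u <= c -> c < d -> d <= v ->
  sigma @` [set` `[disc_plus D c, disc_minus D d]] = [set` hull (T c) (T d)].
Proof.
move=> uc cd dv; apply/seteqP; split.
  by move=> _ [p pI <-]; exact: sigma_hull pI.
have cI : u <= c <= v by rewrite uc (le_trans (ltW cd)).
have dI : u <= d <= v by rewrite dv (le_trans uc (ltW cd)).
have c01 := uv01 cI; have d01 := uv01 dI.
have u01 : 0 <= u <= 1 by rewrite u0 (le_trans (ltW uv)).
have v01 : 0 <= v <= 1 by rewrite v1 (le_trans u0 (ltW uv)).
have Tcd : T c != T d by apply/eqP => /(T_inj cI dI) cdE; rewrite cdE ltxx in cd.
have uvI p : p \in `[disc_plus D c, disc_minus D d] ->
    p \in `[disc_plus D u, disc_minus D v].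
  by apply: disc_itv_sub; rewrite ?u0 ?uc ?dv ?v1// ltW.
have cdP p : p \in `[disc_plus D c, disc_minus D d] ->
    collapse (sigma p) = T (collapse p).
  by move=> /uvI; exact: collapse_sigma.
move=> q /= qh; have [x /andP[cx xd] xq] := T_onto_itv cI dI (ltW cd)
  (hull_collapse (T_itv cI) (T_itv dI) qh).
have pI : disc_plus D c \in `[disc_plus D c, disc_minus D d].
  by rewrite in_itv/= lexx/= ltW// disc_lt// collapse_plus// collapse_minus.
have mI : disc_minus D d \in `[disc_plus D c, disc_minus D d].
  by rewrite in_itv/= lexx/= andbT ltW// disc_lt// collapse_plus// collapse_minus.
(* Over an end value the hull contains a single point, so [q] must be the image of the corresponding
   end of the interval. *)
have [xc|xc] := eqVneq x c.
  exists (disc_plus D c) => //; apply: (hull_end_inj _ _ Tcd) => //.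
  - exact: T_itv.
  - exact: T_itv.
  - exact: sigma_hull pI.
  - by rewrite cdP// collapse_plus.
  - by rewrite -xq xc.
have [xd'|xd'] := eqVneq x d.
  exists (disc_minus D d) => //; rewrite eq_sym in Tcd.
  apply: (hull_end_inj _ _ Tcd) => //.
  - exact: T_itv.
  - exact: T_itv.
  - by rewrite hullC; exact: sigma_hull mI.
  - by rewrite hullC.
  - by rewrite cdP// collapse_minus.
  - by rewrite -xq xd'.
have {xc} cx' : c < x by rewrite lt_neqAle eq_sym xc.
have {xd'} xd'' : x < d by rewrite lt_neqAle xd'.
have xuv : u < x < v by rewrite (le_lt_trans uc)// (lt_le_trans xd'').
have xI : u <= x <= v by case/andP: xuv => /ltW -> /ltW ->.
have x01 := uv01 xI.
have xpI : disc_plus D x \in `[disc_plus D c, disc_minus D d].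
  by rewrite in_itv/= plus_le// le_minus// collapse_plus// cx' xd''.
have xmI : disc_minus D x \in `[disc_plus D c, disc_minus D d].
  by rewrite in_itv/= plus_le// le_minus// collapse_minus// cx' xd''.
have [sx|nsx] := boolP (split_point D x); last first.
  exists (disc_minus D x) => //; apply: disc_eq_nsplit.
    by rewrite cdP// collapse_minus.
  rewrite cdP// collapse_minus//; apply: contra nsx => /and3P[/set_mem + _ _].
  move=> /(T_D xuv) Dx; rewrite /split_point mem_set//= gt_eqF ?lt_eqF//.
    by case/andP: xuv => _ /lt_le_trans; apply.
  by case/andP: xuv => /(le_lt_trans u0).
have sTx := split_T xuv sx.
(* At most two points lie over [T x], told apart by their Boolean; the images of x^- and x^+ are
   distinct points over [T x], so [q] is one of them. *)
suff [<-|<-] : sigma (disc_minus D x) = q \/ sigma (disc_plus D x) = q.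
- by exists (disc_minus D x).
- by exists (disc_plus D x).
have ne : sigma (disc_minus D x) <> sigma (disc_plus D x).
  move=> /sigma_inj; move=> /(_ (uvI _ xmI) (uvI _ xpI)).
  move=> /(congr1 (fun r => (disc_val r).2)).
  by rewrite disc_val_minus// disc_val_plus//= sx.
have e1 : collapse (sigma (disc_minus D x)) = T x by rewrite cdP// collapse_minus.
have e2 : collapse (sigma (disc_plus D x)) = T x by rewrite cdP// collapse_plus.
have [q2|q2] := eqVneq (disc_val q).2 (disc_val (sigma (disc_minus D x))).2.
  by left; apply: disc_eq => //; rewrite e1.
right; apply: disc_eq; rewrite ?e2//; apply: contra_not_eq ne => q2'.
apply: disc_eq; rewrite ?e1//; move: q2 q2'.
by case: (_.2); case: (_.2); case: (_.2).
Qed.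

End Branch.

(** * Extension of a monotonic function to the end points *)

Section OneSidedExtension.
Variable R : realType.
Implicit Types (f : R -> R) (u v x y l r : R).

Lemma near_right_itv u v : u < v -> \forall z \near u^'+, u < z < v.
Proof.
move=> uv; near=> z; apply/andP; split; near: z.
  exact: nbhs_right_gt.
exact: nbhs_right_lt.
Unshelve. all: by end_near. Qed.

Lemma near_left_itv u v : u < v -> \forall z \near v^'-, u < z < v.
Proof.
move=> uv; near=> z; apply/andP; split; near: z.
  exact: nbhs_left_gt.
exact: nbhs_left_lt.
Unshelve. all: by end_near. Qed.

(** Abstract form of [branch], with the end values as parameters instead of limits, so that it can
    be negated. *)
Definition itv_ext f u v l r x :=
  if x == u then l else if x == v then r else f x.

(** Passing to a limit only preserves weak inequalities. Two interior points [z < w] between [x] and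
    [y] keep the strictness: the value at [x] is at most [f z], and the value at [y] at least
    [f w]. *)
Lemma itv_ext_incr f u v l r :
  {in `]u, v[ &, forall x y, x < y -> f x < f y} ->
  f z @[z --> u^'+] --> l -> f z @[z --> v^'-] --> r ->
  {in `[u, v] &, {homo itv_ext f u v l r : x y / x < y}}.
Proof.
move=> incr ful fvr x y; rewrite !in_itv/= => /andP[ux xv] /andP[uy yv] xy.
have fI z w : u < z -> z < w -> w < v -> f z < f w.
  by move=> uz zw wv; apply: incr => //; rewrite in_itv/=; lra.
pose z := x + (y - x) / 3; pose w := x + (y - x) * 2 / 3.
have [xz zw wy] : [/\ x < z, z < w & w < y] by rewrite /z /w; split; lra.
have xfz : itv_ext f u v l r x <= f z.
  rewrite /itv_ext; case: eqVneq => [xu|xu].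
    have uz : u < z by rewrite -xu.
    apply: (cvgr_to_le ful); near=> t.
    have /andP[ut tz] : u < t < z by near: t; exact: near_right_itv.
    by rewrite ltW// fI//; lra.
  rewrite lt_eqF; last by lra.
  by rewrite ltW// fI//; [rewrite lt_neqAle eq_sym xu|lra].
have wfy : f w <= itv_ext f u v l r y.
  rewrite /itv_ext gt_eqF; last by lra.
  case: eqVneq => [yv'|yv'].
    have wv : w < v by rewrite -yv'.
    apply: (cvgr_to_ge fvr); near=> t.
    have /andP[wt tv] : w < t < v by near: t; exact: near_left_itv.
    by rewrite ltW// fI//; lra.
  by rewrite ltW// fI//; [lra|rewrite lt_neqAle yv'].
rewrite (le_lt_trans xfz)// (lt_le_trans _ wfy)// fI//; lra.
Unshelve. all: by end_near. Qed.

Lemma itv_ext_decr f u v l r :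
  {in `]u, v[ &, forall x y, x < y -> f y < f x} ->
  f z @[z --> u^'+] --> l -> f z @[z --> v^'-] --> r ->
  {in `[u, v] &, {homo itv_ext f u v l r : x y /~ x < y}}.
Proof.
move=> decr /cvgN ful /cvgN fvr x y xI yI xy.
have extN t : itv_ext (- f) u v (- l) (- r) t = - itv_ext f u v l r t.
  by rewrite /itv_ext; case: ifP => // _; case: ifP.
rewrite -ltrN2 -!extN; apply: (itv_ext_incr _ ful fvr) => // z w zI wI zw.
by rewrite [X in X < _]/GRing.opp [X in _ < X]/GRing.opp /= ltrN2 decr.
Qed.

Lemma strictly_monotonic_cvg f u v b c : u < v ->
  strictly_monotonic_on f `]u, v[ ->
  {in `]u, v[, forall x, b <= f x <= c} ->
  cvg (f z @[z --> u^'+]) /\ cvg (f z @[z --> v^'-]).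
Proof.
wlog incr : f b c / {in `]u, v[ &, forall x y, x < y -> f x < f y}.
  move=> wl uv [mono|mono] fbc.
    apply: (wl f b c) => //; last by left.
    by move=> x y xI yI; apply: mono; exact: mem_set.
  have Ninc : {in `]u, v[ &, forall x y, x < y -> (- f) x < (- f) y}.
    move=> x y xI yI xy; rewrite [X in X < _]/GRing.opp [X in _ < X]/GRing.opp /=.
    by rewrite ltrN2; apply: mono => //; exact: mem_set.
  have [||cu cv] := wl (- f) (- c) (- b) Ninc uv.
  - by left => x y /set_mem xI /set_mem yI; exact: Ninc.
  - by move=> x /fbc; rewrite [(- f) x]/GRing.opp/= !lerN2 andbC.
  - by split; [move: cu|move: cv]; rewrite is_cvgNE.
move=> uv _ fbc; split.
  apply: nondecreasing_at_right_is_cvgr.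
    near=> t => x y; rewrite !in_itv/= => xI yI.
    have /andP[ut tv] : u < t < v by near: t; exact: near_right_itv.
    rewrite le_eqVlt => /orP[/eqP ->//|xy]; rewrite ltW// incr// in_itv/=; lra.
  near=> t; exists b => _ [x /= xI <-].
  have /andP[ut tv] : u < t < v by near: t; exact: near_right_itv.
  have /fbc/andP[->]// : x \in `]u, v[.
  by move: xI; rewrite !in_itv/=; lra.
apply: nondecreasing_at_left_is_cvgr.
  near=> t => x y; rewrite !in_itv/= => xI yI.
  have /andP[ut tv] : u < t < v by near: t; exact: near_left_itv.
  rewrite le_eqVlt => /orP[/eqP ->//|xy]; rewrite ltW// incr// in_itv/=; lra.
near=> t; exists c => _ [x /= xI <-].
have /andP[ut tv] : u < t < v by near: t; exact: near_left_itv.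
have /fbc/andP[]// : x \in `]u, v[.
by move: xI; rewrite !in_itv/=; lra.
Unshelve. all: by end_near. Qed.

Lemma itv_ext_continuous f u v l r : u < v -> {in `]u, v[, continuous f} ->
  f z @[z --> u^'+] --> l -> f z @[z --> v^'-] --> r ->
  {within `[u, v], continuous (itv_ext f u v l r)}.
Proof.
move=> uv cf ful fvr.
have extE z : u < z < v -> f z = itv_ext f u v l r z.
  by move=> /andP[uz zv]; rewrite /itv_ext gt_eqF// lt_eqF.
apply/continuous_within_itvP => //; split.
- move=> x xI; rewrite /continuous_at -extE; last by rewrite in_itv/= in xI.
  apply: cvg_trans (cf x xI); apply: near_eq_cvg.
  have := near_in_itvoo xI; apply: filterS => z zI.
  by apply: extE; rewrite in_itv/= in zI.
- rewrite {2}/itv_ext eqxx; apply: cvg_trans ful; apply: near_eq_cvg.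
  by apply: filterS (near_right_itv uv) => z; exact: extE.
- rewrite {2}/itv_ext gt_eqF// eqxx; apply: cvg_trans fvr; apply: near_eq_cvg.
  by apply: filterS (near_left_itv uv) => z; exact: extE.
Qed.

(** Otherwise the interval would be countable, hence of Lebesgue measure 0, whereas its measure is
    [y - x]. *)
Lemma countable_codense (A : set R) x y : countable A -> x < y ->
  exists2 r, x < r < y & ~ A r.
Proof.
move=> cA xy; apply: contrapT => nr.
have cxy : countable (`]x, y[ : set R).
  apply: sub_countable cA; apply: subset_card_le => r /=; rewrite in_itv/= => rI.
  by apply: contrapT => nAr; apply: nr; exists r.
have := countable_lebesgue_measure0 cxy; rewrite lebesgue_measure_itv/= lte_fin xy.
by rewrite -EFinD => /eqP; rewrite eqe subr_eq0 gt_eqF.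
Qed.

End OneSidedExtension.

(** * The generalized orbit *)

Section Orbit.
Variables (R : realType) (tau : R -> R) (n : nat) (a : nat -> R).
Hypothesis pm : piecewise_monotonic tau n a.
Implicit Types (x y : R) (i j : nat).
Local Notation C := (partition_set n a).
Local Notation I1 := (generalized_orbit tau C).

Lemma tau_itv x : 0 <= x <= 1 -> 0 <= tau x <= 1.
Proof.
by case: pm => tauI _ xI; have := tauI x; rewrite /unit_itv/= !in_itv/=; apply.
Qed.

Lemma part0 : a 0%N = 0. Proof. by case: pm => _ []. Qed.

Lemma partn : a n = 1. Proof. by case: pm => _ []. Qed.

Lemma part_ltS i : (i < n)%N -> a i < a i.+1.
Proof. by case: pm => _ [_ _ h _]; exact: h. Qed.

Lemma part_le i j : (i <= j <= n)%N -> a i <= a j.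
Proof.
elim: j => [|j IHj]; first by rewrite leqn0 => /andP[/eqP->].
rewrite leq_eqVlt => /andP[/orP[/eqP ->//|]]; rewrite ltnS => ij jn.
by apply: le_trans (IHj _) (ltW (part_ltS jn)); rewrite ij ltnW.
Qed.

Lemma part_itv i : (i <= n)%N -> 0 <= a i <= 1.
Proof. by move=> ni; rewrite -part0 -partn !part_le ?leq0n ?ni ?leqnn. Qed.

Lemma partition_setP i : (i <= n)%N -> C (a i).
Proof. by move=> ni; exists i. Qed.

Lemma part_cover x : 0 <= x <= 1 ->
  C x \/ exists2 i, (i < n)%N & a i < x < a i.+1.
Proof.
move=> /andP[x0 x1].
have : forall k, (k <= n)%N -> x <= a k ->
    C x \/ exists2 i, (i < n)%N & a i < x < a i.+1.
  elim => [_|k IHk kn xk].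
    rewrite part0 => x0'; left; exists 0%N => //.
    by rewrite part0; apply: le_anti; rewrite x0.
  have [xk'|kx] := leP x (a k); first exact: IHk (ltnW kn) xk'.
  move: xk; rewrite le_eqVlt => /orP[/eqP ->|xk].
    by left; exact: partition_setP.
  by right; exists k => //; rewrite kx.
by move=> /(_ n (leqnn n)); apply; rewrite partn.
Qed.

Lemma part_mono i : (i < n)%N -> continuous_monotonic_on tau (a i) (a i.+1).
Proof. by case: pm => _ [_ _ _]; exact. Qed.

Lemma part_between_itv i x : (i < n)%N -> a i < x < a i.+1 -> 0 <= x <= 1.
Proof.
move=> ni /andP[ax xa]; have /andP[a0 _] := part_itv (ltnW ni).
have /andP[_ a1] := part_itv ni.
by rewrite (le_trans a0 (ltW ax)) (le_trans (ltW xa)).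
Qed.

(** * Branches and one-sided limits at the partition points *)

Lemma branch_cvg i : (i < n)%N ->
  tau z @[z --> (a i)^'+] --> branch tau a i.+1 (a i) /\
  tau z @[z --> (a i.+1)^'-] --> branch tau a i.+1 (a i.+1).
Proof.
move=> ni; have ii := part_ltS ni.
rewrite /branch/= !eqxx gt_eqF//.
(* Monotonicity and the bounds 0 and 1 make both limits exist, so the [lim] terms in [branch] are
   genuine limits here. *)
have [] := @strictly_monotonic_cvg _ tau (a i) (a i.+1) 0 1 ii.
- by case: (part_mono ni).
- by move=> x; rewrite in_itv/= => xI; exact: tau_itv (part_between_itv ni xI).
- by move=> cu cv; split; [exact: cu|exact: cv].
Qed.

Lemma branchE i : (i < n)%N -> branch tau a i.+1 =
  itv_ext tau (a i) (a i.+1) (branch tau a i.+1 (a i)) (branch tau a i.+1 (a i.+1)).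
Proof.
move=> ni; apply/funext => x; rewrite /itv_ext /branch /= !eqxx.
by rewrite (gt_eqF (part_ltS ni)).
Qed.

Lemma branch_in i x : a i < x < a i.+1 -> branch tau a i.+1 x = tau x.
Proof. by move=> /andP[ax xa]; rewrite /branch/= gt_eqF// lt_eqF. Qed.

Lemma branch_mono i : (i < n)%N ->
  {in `[a i, a i.+1] &, {mono branch tau a i.+1 : x y / x <= y}} \/
  {in `[a i, a i.+1] &, {mono branch tau a i.+1 : x y /~ x <= y}}.
Proof.
move=> ni; have [ful fvr] := branch_cvg ni; have [_ mono] := part_mono ni.
rewrite branchE//; case: mono => mono; [left|right].
- apply: le_mono_in; apply: itv_ext_incr => // x y xI yI.
  by apply: mono; exact: mem_set.
- apply: le_nmono_in; apply: itv_ext_decr => // x y xI yI.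
  by apply: mono; exact: mem_set.
Qed.

Lemma branch_onto i w : (i < n)%N ->
  Num.min (branch tau a i.+1 (a i)) (branch tau a i.+1 (a i.+1)) <= w
    <= Num.max (branch tau a i.+1 (a i)) (branch tau a i.+1 (a i.+1)) ->
  exists2 x, a i <= x <= a i.+1 & branch tau a i.+1 x = w.
Proof.
move=> ni wI; have ii := part_ltS ni; have [ful fvr] := branch_cvg ni.
have cT := itv_ext_continuous ii (proj1 (part_mono ni)) ful fvr.
rewrite -branchE// in cT; have [x xI xw] := IVT (ltW ii) cT wI.
by exists x => //; rewrite in_itv/= in xI.
Qed.

Lemma hat_branch_left i : (i < n)%N -> hat tau (a i) (branch tau a i.+1 (a i)).
Proof.
move=> ni; right; split; last by case: (branch_cvg ni).
by rewrite -partn (lt_le_trans (part_ltS ni))// part_le// ni leqnn.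
Qed.

Lemma hat_branch_right i : (i < n)%N ->
  hat tau (a i.+1) (branch tau a i.+1 (a i.+1)).
Proof.
move=> ni; left; split; last by case: (branch_cvg ni).
by apply: le_lt_trans (part_ltS ni); case/andP: (part_itv (ltnW ni)).
Qed.

(** Uniqueness of limits. Branch [j.+1] lives on [[a j, a j.+1]], so the left limit at [a i] belongs
    to branch [i] and the right limit to branch [i.+1]; the former is absent for [i = 0], the latter
    for [i = n]. *)
Lemma hat_partition i y : (i <= n)%N -> hat tau (a i) y ->
  (exists2 j, i = j.+1 & y = branch tau a j.+1 (a j.+1)) \/
  ((i < n)%N /\ y = branch tau a i.+1 (a i)).
Proof.
move=> ni [[a0 ty]|[a1 ty]].
  left; case: i ni a0 ty => [|j] jn a0 ty; first by rewrite part0 ltxx in a0.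
  exists j => //.
  by have [_ /(cvg_unique (@norm_hausdorff _ _) ty)] := branch_cvg jn.
right; have i_n : (i < n)%N.
  rewrite ltn_neqAle ni andbT; apply/eqP => i_n.
  by rewrite i_n partn ltxx in a1.
by split=> //; have [/(cvg_unique (@norm_hausdorff _ _) ty)] := branch_cvg i_n.
Qed.

Lemma hat_between i x y : (i < n)%N -> a i < x < a i.+1 ->
  hat tau x y <-> y = tau x.
Proof.
move=> ni xI; have [ct _] := part_mono ni.
have cx : tau z @[z --> x] --> tau x by apply: ct; rewrite in_itv.
split=> [[[_]|[_]] ty|->].
- exact: (cvg_unique (@norm_hausdorff _ _) ty (cvg_at_left_filter cx)).
- exact: (cvg_unique (@norm_hausdorff _ _) ty (cvg_at_right_filter cx)).
- left; split; last exact: cvg_at_left_filter.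
  case/andP: xI => ax _; rewrite (le_lt_trans _ ax)//.
  by case/andP: (part_itv (ltnW ni)).
Qed.

Lemma hat_itv x y : 0 <= x <= 1 -> hat tau x y -> 0 <= y <= 1.
Proof.
move=> /andP[x0 x1] [[x0' ty]|[x1' ty]].
- have tI : \forall z \near x^'-, 0 <= tau z <= 1.
    by apply: filterS (near_left_itv x0') => z /andP[z0 zx]; apply: tau_itv; lra.
  apply/andP; split.
    by apply: (cvgr_to_ge ty); apply: filterS tI => z /andP[].
  by apply: (cvgr_to_le ty); apply: filterS tI => z /andP[].
- have tI : \forall z \near x^'+, 0 <= tau z <= 1.
    by apply: filterS (near_right_itv x1') => z /andP[z0 zx]; apply: tau_itv; lra.
  apply/andP; split.
    by apply: (cvgr_to_ge ty); apply: filterS tI => z /andP[].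
  by apply: (cvgr_to_le ty); apply: filterS tI => z /andP[].
Qed.

(** * Closure properties of the generalized orbit *)

Lemma orbit_partition : C `<=` I1.
Proof. exact: sub_gen_smallest. Qed.

Lemma orbit_itv x : I1 x -> 0 <= x <= 1.
Proof.
suff : I1 `<=` @unit_itv R by move=> /[apply]; rewrite /unit_itv/= in_itv.
apply: smallest_sub.
  split => //; last by move=> y [].
  move=> y [z]; rewrite /unit_itv/= !in_itv/=; exact: hat_itv.
by move=> _ [i ni <-]; rewrite /unit_itv/= in_itv/=; exact: part_itv.
Qed.

(** The orbit is an intersection of invariant sets, so closure is checked in each of them. *)
Lemma orbit_hat x y : I1 x -> hat tau x y -> I1 y.
Proof.
move=> Ix xy A HA; case: (HA) => -[_ Ahat _] _; apply: Ahat; exists x => //.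
exact: Ix A HA.
Qed.

Lemma orbit_hat_preimage x y : 0 <= x <= 1 -> hat tau x y -> I1 y -> I1 x.
Proof.
move=> xI xy Iy A HA; case: (HA) => -[_ _ Apre] _; apply: Apre; split.
  by rewrite /unit_itv/= in_itv.
by exists y; split => //; exact: Iy A HA.
Qed.

Lemma orbit_between i x : (i < n)%N -> a i < x < a i.+1 -> I1 x <-> I1 (tau x).
Proof.
move=> ni xI; have xh : hat tau x (tau x) by apply/(hat_between _ ni xI).
split=> [Ix|]; first exact: orbit_hat xh.
by apply: orbit_hat_preimage xh; exact: part_between_itv xI.
Qed.

(** * Countability of the generalized orbit *)

Lemma hat_image_countable (A : set R) : countable A -> countable (hat_image tau A).
Proof.
move=> cA; apply: bigcup_countable => // x _; apply: finite_set_countable.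
(* Where a one-sided limit fails to exist, [lim] only adds a harmless extra element to this finite
   superset of [hat tau x]. *)
pose s := [set lim (tau z @[z --> x^'-]); lim (tau z @[z --> x^'+])].
apply: (@sub_finite_set _ _ s); last exact: finite_set2.
by move=> y [[_ /cvg_lim-/(_ (@norm_hausdorff _ _)) <-]|
  [_ /cvg_lim-/(_ (@norm_hausdorff _ _)) <-]]; [left|right].
Qed.

Lemma countableU (T : Type) (A B : set T) :
  countable A -> countable B -> countable (A `|` B).
Proof.
move=> cA cB; rewrite (_ : _ `|` _ = \bigcup_(b in [set: bool]) if b then A else B).
  by apply: bigcup_countable => // -[].
apply/seteqP; split=> [x [Ax|Bx]|x [[] _ Ax]].
- by exists true.
- by exists false.
- by left.
- by right.
Qed.

Lemma subset1_countable (T : Type) (A : set T) :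
  (forall s t, A s -> A t -> s = t) -> countable A.
Proof.
move=> A1; have [->|/set0P[x Ax]] := eqVneq A set0; first exact: countable0.
apply: sub_countable (countable1 x); apply: subset_card_le => y Ay.
exact: A1.
Qed.

Lemma partition_countable : countable C.
Proof.
apply: finite_set_countable; apply: finite_image.
by apply: sub_finite_set (finite_II n.+1) => i; rewrite /= ltnS.
Qed.

(** Apart from points of the partition, a value has at most one preimage in each open piece, by
    strict monotonicity; [F] indexes these preimages by piece and value. *)
Lemma hat_preimage_countable (A : set R) :
  countable A -> countable (hat_preimage tau A).
Proof.
move=> cA.
pose F (p : nat * R) := [set x |
  (p.1 < n)%N /\ (a p.1 < x < a p.1.+1 /\ tau x = p.2)].
apply: (@sub_countable _ _ _ (C `|` \bigcup_(p in setT `*` A) F p)); last first.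
  have cB : countable (\bigcup_(p in setT `*` A) F p).
    apply: bigcup_countable; first by apply: countableX => //; exact: countableP.
    move=> -[i y] _; apply: subset1_countable => x x' [/= ni [xI <-]] [_ [x'I xx']].
    have [_ mono] := part_mono ni; apply: contrapT => /eqP; rewrite neq_lt.
    have xm : x \in [set` `]a i, a i.+1[] by apply/mem_set; rewrite /= in_itv.
    have xm' : x' \in [set` `]a i, a i.+1[] by apply/mem_set; rewrite /= in_itv.
    case: mono => m /orP[] xx.
    - by have := m _ _ xm xm' xx; rewrite xx' ltxx.
    - by have := m _ _ xm' xm xx; rewrite xx' ltxx.
    - by have := m _ _ xm xm' xx; rewrite xx' ltxx.
    - by have := m _ _ xm' xm xx; rewrite xx' ltxx.
  exact: countableU partition_countable cB.
apply: subset_card_le => x [xI [y [xy Ay]]].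
have [Cx|[i ni ix]] := part_cover xI; [by left|right].
exists (i, y) => //; split => //=; split => //.
by apply/esym/(hat_between _ ni ix).
Qed.

(** The sets [B k], obtained from the partition by alternately adjoining images and preimages, are
    countable, and their union is invariant, so it contains the orbit. *)
Lemma orbit_countable : countable I1.
Proof.
pose step A := A `|` (hat_image tau A `|` hat_preimage tau A).
pose B k := iter k step C.
have cB k : countable (B k).
  elim: k => [|k IHk]; first exact: partition_countable.
  apply: countableU => //; apply: countableU.
    exact: hat_image_countable.
  exact: hat_preimage_countable.
have BI k : B k `<=` @unit_itv R.
  elim: k => [_ [i ni <-]|k IHk y].
    by rewrite /unit_itv/= in_itv/=; exact: part_itv.
  case=> [/IHk//|[[x /IHk]|[]//]].
  by rewrite /unit_itv/= !in_itv/=; exact: hat_itv.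
have : I1 `<=` \bigcup_(k in setT) B k.
  apply: smallest_sub; last by move=> x Cx; exists 0%N.
  split.
  - by move=> x [k _]; exact: BI.
  - by move=> y [x [k _ Bx] xy]; exists k.+1 => //; right; left; exists x.
  - move=> x [xI [y [xy [k _ By]]]]; exists k.+1 => //.
    by right; right; split=> //; exists y.
move=> /subset_card_le /sub_countable; apply.
by apply: bigcup_countable.
Qed.

Lemma orbit_codense x y : x < y -> exists2 r, x < r < y & ~ I1 r.
Proof. exact: countable_codense orbit_countable. Qed.

End Orbit.

(** * The transfer map on intervals *)

Section TransferIndicator.
Variables (X : topologicalType) (sigma : X -> X).
Hypothesis fiber_finite : forall x, finite_set (sigma @^-1` [set x]).

(** Each fiber meets [K] in at most one point, so the sum has at most one nonzero term. Finiteness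
    matters because [fset_set] is empty on an infinite fiber. *)
Lemma transfer_indic (K : set X) : {in K &, injective sigma} ->
  transfer sigma \1_K = \1_(sigma @` K).
Proof.
move=> injK; apply/funext => x; rewrite /transfer !indicE.
have [/set_mem[p Kp px]|/negP nKx] := boolP (x \in sigma @` K).
  rewrite (bigD1_seq p) ?fset_uniq//=; last by rewrite in_fset_set// inE.
  rewrite indicE mem_set// big1_seq ?addr0// => q /andP[qp].
  rewrite in_fset_set// => /set_mem/= qx; rewrite indicE.
  case: (boolP (q \in K)) => // qK; case/eqP: qp.
  by apply: injK => //; [exact: mem_set|rewrite qx].
rewrite big1_seq// => q /=; rewrite in_fset_set// => /set_mem/= qx; rewrite indicE.
case: (boolP (q \in K)) => // /set_mem qK; case: nKx; apply: mem_set.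
by exists q.
Qed.

End TransferIndicator.

(** * The branches of [tau] under the lift, and continuity of the transfer map *)

Section Assembly.
Variables (R : realType) (tau : R -> R) (n : nat) (a : nat -> R).
Local Notation C := (partition_set n a).
Local Notation I1 := (generalized_orbit tau C).
Local Notation X := (disconnection I1).
Variable sigma : X -> X.
Hypothesis pm : piecewise_monotonic tau n a.
Hypothesis sigma_assoc : associated_map sigma.
Implicit Types (x y c d : R) (i j : nat) (p q : X).
Local Notation T i := (branch tau a i.+1).

Lemma branch_orbit i x : (i < n)%N -> a i <= x <= a i.+1 -> I1 x -> I1 (T i x).
Proof.
move=> ni /andP[]; rewrite le_eqVlt => /orP[/eqP <- _ Ia|ax].
  exact: (orbit_hat Ia (hat_branch_left pm ni)).
rewrite le_eqVlt => /orP[/eqP -> Ia|xa Ix].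
  exact: (orbit_hat Ia (hat_branch_right pm ni)).
have xI : a i < x < a i.+1 by rewrite ax.
by rewrite branch_in//; apply/(orbit_between pm ni xI).
Qed.

Lemma branch_itv i x : (i < n)%N -> a i <= x <= a i.+1 -> 0 <= T i x <= 1.
Proof.
move=> ni /andP[]; rewrite le_eqVlt => /orP[/eqP <- _|ax].
  exact: (hat_itv pm (part_itv pm (ltnW ni)) (hat_branch_left pm ni)).
rewrite le_eqVlt => /orP[/eqP ->|xa].
  exact: (hat_itv pm (part_itv pm ni) (hat_branch_right pm ni)).
have xI : a i < x < a i.+1 by rewrite ax.
by rewrite branch_in//; exact: (tau_itv pm (part_between_itv pm ni xI)).
Qed.

Lemma orbit_disc_codense x y : 0 <= x -> x < y -> y <= 1 ->
  exists2 r, x < r < y & ~ I1 r.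
Proof. by move=> _ xy _; exact: (orbit_codense pm xy). Qed.

Lemma branch_orbit_iff i x : (i < n)%N -> a i < x < a i.+1 ->
  I1 x <-> I1 (T i x).
Proof. by move=> ni xI; rewrite branch_in//; exact: (orbit_between pm ni xI). Qed.

Lemma collapse_sigma_branch i p : (i < n)%N -> a i < collapse p < a i.+1 ->
  ~ I1 (collapse p) -> collapse (sigma p) = T i (collapse p).
Proof.
move=> ni pI nI; rewrite branch_in//; apply: (proj2 sigma_assoc); split => //.
by rewrite /unit_itv/= in_itv/=; exact: (part_between_itv pm ni pI).
Qed.

Lemma sigma_piece_inj i p q : (i < n)%N ->
  p \in `[disc_plus I1 (a i), disc_minus I1 (a i.+1)] ->
  q \in `[disc_plus I1 (a i), disc_minus I1 (a i.+1)] ->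
  sigma p = sigma q -> p = q.
Proof.
move=> ni; have /andP[a0 _] := part_itv pm (ltnW ni).
have /andP[_ a1] := part_itv pm ni.
apply: (sigma_inj orbit_disc_codense (proj1 sigma_assoc) a0 (part_ltS pm ni) a1
  (fun x => branch_itv ni) (branch_mono pm ni) (fun w => branch_onto pm ni)
  (fun x => branch_orbit_iff ni) (fun p => collapse_sigma_branch ni)).
Qed.

Lemma sigma_piece_image i c d : (i < n)%N -> a i <= c -> c < d -> d <= a i.+1 ->
  sigma @` [set` `[disc_plus I1 c, disc_minus I1 d]] =
  [set` hull I1 (T i c) (T i d)].
Proof.
move=> ni; have /andP[a0 _] := part_itv pm (ltnW ni).
have /andP[_ a1] := part_itv pm ni.
apply: (sigma_itv_image orbit_disc_codense (proj1 sigma_assoc) a0 (part_ltS pm ni) a1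
  (fun x => branch_itv ni) (branch_mono pm ni) (fun w => branch_onto pm ni)
  (fun x => branch_orbit_iff ni) (fun p => collapse_sigma_branch ni)).
Qed.

(** Over a partition point, the upper point goes to the piece on its right and the lower one to the
    piece on its left. The exception is 0, which is not split and opens the first piece. *)
Lemma disc_piece_cover p : exists2 i, (i < n)%N &
  p \in `[disc_plus I1 (a i), disc_minus I1 (a i.+1)].
Proof.
have pieceE i : (i < n)%N -> p \in `[disc_plus I1 (a i), disc_minus I1 (a i.+1)] =
    ((a i < collapse p) || ((a i == collapse p) &&
      (split_point I1 (a i) ==> (disc_val p).2))) &&
    ((collapse p < a i.+1) || ((collapse p == a i.+1) && ~~ (disc_val p).2)).
  move=> ni; have a0 := part_itv pm (ltnW ni); have a1 := part_itv pm ni.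
  by rewrite in_itv/= plus_le// le_minus.
have [[i /= ni ip]|[i ni /andP[ap pa]]] := part_cover pm (collapse_itv p); last first.
  by exists i => //; rewrite pieceE// ap pa.
have [p2|p2] := boolP (disc_val p).2.
  have i_n : (i < n)%N.
    rewrite ltn_neqAle ni andbT; apply/eqP => i_n.
    by have := disc_split p2; rewrite /split_point -ip i_n (partn pm) eqxx !andbF.
  by exists i => //; rewrite pieceE// ip eqxx p2 implybT orbT -ip (part_ltS pm).
case: i ni ip => [_|i ni] ip.
  have n0 : (0 < n)%N.
    rewrite lt0n; apply/eqP => n0; have := partn pm; rewrite n0 (part0 pm).
    by move/eqP; rewrite eq_sym oner_eq0.
  exists 0%N => //; rewrite pieceE// ip eqxx -ip (part_ltS pm)// andbT.
  by rewrite /split_point (part0 pm) eqxx andbF orbT.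
by exists i => //; rewrite pieceE// -ip (part_ltS pm)//= eqxx p2 orbT.
Qed.

Lemma sigma_fiber_finite q : finite_set (sigma @^-1` [set q]).
Proof.
pose F i := sigma @^-1` [set q] `&`
  [set` `[disc_plus I1 (a i), disc_minus I1 (a i.+1)]].
apply: (@sub_finite_set _ _ (\bigcup_(i in `I_n) F i)).
  by move=> p pq; have [i ni pI] := disc_piece_cover p; exists i.
apply: bigcup_finite; first exact: finite_II.
move=> i /= ni; have [->|/set0P[p [pq pI]]] := eqVneq (F i) set0.
  exact: finite_set0.
apply: sub_finite_set (finite_set1 p) => p' [p'q p'I].
by apply: (sigma_piece_inj ni p'I pI); rewrite pq.
Qed.

Lemma transferD (f g : X -> int) :
  transfer sigma (f + g) = transfer sigma f + transfer sigma g.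
Proof. exact: (iter_transferD sigma 1). Qed.

Lemma transferN (f : X -> int) : transfer sigma (- f) = - transfer sigma f.
Proof. exact: (iter_transferN sigma 1). Qed.

(** The difference is, up to sign, the indicator of an interval that [sigma] maps bijectively onto
    the hull of the two images. The sign in the conclusion records whether the branch preserves or
    reverses the order, which is immaterial for subgroups. *)
Lemma transfer_below i c d : (i < n)%N ->
  a i <= c <= a i.+1 -> a i <= d <= a i.+1 -> I1 c -> I1 d ->
  let g := below I1 (T i d) - below I1 (T i c) in
  transfer sigma (below I1 d - below I1 c) = g \/
  transfer sigma (below I1 d - below I1 c) = - g.
Proof.
move=> ni; wlog cd : c d / c <= d.
  move=> wl cI dI Ic Id /=; case/orP: (le_total c d) => [cd|dc]; first exact: wl.
  have [E|E] := wl d c dc dI cI Id Ic; rewrite -[below I1 d - _]opprB transferN E.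
    by left; rewrite opprB.
  by right; rewrite opprK opprB.
move=> /andP[ac ca] /andP[ad da] Ic Id /=.
move: cd; rewrite le_eqVlt => /orP[/eqP <-|cd].
  (* For [c = d] both sides vanish; that the transfer of 0 is 0 is extracted from [transferN] and
     [transferD]. *)
  by left; rewrite !subrr; have := transferN 0; rewrite oppr0 => /eqP;
    rewrite -addr_eq0 -transferD addr0 => /eqP.
have /andP[c0 c1] := orbit_itv pm Ic; have /andP[d0 d1] := orbit_itv pm Id.
rewrite -indic_itvE// transfer_indic; first last.
- have a0 : 0 <= a i <= c by case/andP: (part_itv pm (ltnW ni)) => ->.
  have a1 : d <= a i.+1 <= 1 by case/andP: (part_itv pm ni) => _ ->; rewrite da.
  move=> p q /set_mem pI /set_mem qI; apply: (sigma_piece_inj ni).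
    exact: (disc_itv_sub a0 (ltW cd) a1 pI).
  exact: (disc_itv_sub a0 (ltW cd) a1 qI).
- exact: sigma_fiber_finite.
rewrite (sigma_piece_image ni ac cd da) /hull.
have ITc : I1 (T i c) by apply: branch_orbit; rewrite ?ac.
have ITd : I1 (T i d) by apply: branch_orbit; rewrite ?ad.
have /andP[Tc0 Tc1] := branch_itv ni (introT andP (conj ac ca)).
have /andP[Td0 Td1] := branch_itv ni (introT andP (conj ad da)).
have Tcd_neq : T i c != T i d.
  apply/eqP => /(T_inj (branch_mono pm ni)) cdE.
  by move: cd; rewrite cdE ?ltxx ?ac ?ca ?ad ?da.
case/orP: (le_total (T i c) (T i d)) => [Tcd|Tdc].
  rewrite min_l// max_r//; left; apply: indic_itvE => //.
  by rewrite lt_neqAle Tcd_neq.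
rewrite min_r// max_l//; right; rewrite opprB; apply: indic_itvE => //.
by rewrite lt_neqAle eq_sym Tcd_neq.
Qed.

(** By [cont_int_ind] it suffices to treat the functions [below x]. These are reached from
    [below 0 = 0] by crossing the pieces one after the other, each step being given by
    [transfer_below]. *)
Lemma transfer_continuous (f : X -> int) :
  f \in @continuous_int X -> transfer sigma f \in @continuous_int X.
Proof.
have I1C i : (i <= n)%N -> I1 (a i).
  by move=> ni; apply: orbit_partition; exact: partition_setP.
have t0 : transfer sigma 0 \in @continuous_int X.
  rewrite (_ : transfer sigma 0 = 0); first exact: rpred0.
  by apply/funext => x; rewrite /transfer big1.
have step i x : (i < n)%N -> a i <= x <= a i.+1 -> I1 x ->
    transfer sigma (below I1 (a i)) \in @continuous_int X ->
    transfer sigma (below I1 x) \in @continuous_int X.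
  move=> ni xI Ix ci; rewrite -(subrK (below I1 (a i)) (below I1 x)) transferD.
  apply: rpredD => //.
  have aI : a i <= a i <= a i.+1 by rewrite lexx ltW// (part_ltS pm).
  have Ia := I1C _ (ltnW ni).
  have cb y : I1 y -> below I1 y \in @continuous_int X.
    by move=> Iy; apply: below_cont => //; exact: (orbit_itv pm Iy).
  have ITx := cb _ (branch_orbit ni xI Ix); have ITa := cb _ (branch_orbit ni aI Ia).
  by have [->|->] := transfer_below ni aI xI Ia Ix; rewrite ?rpredN rpredB.
have cpart i : (i <= n)%N -> transfer sigma (below I1 (a i)) \in @continuous_int X.
  elim: i => [_|i IHi ni]; first by rewrite (part0 pm) below0.
  apply: (step i) => //; [|exact: I1C|exact: IHi (ltnW ni)].
  by rewrite lexx andbT ltW// (part_ltS pm).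
apply: (@cont_int_ind _ I1 (fun f => transfer sigma f \in @continuous_int X)).
- by rewrite -(partn pm); exact: I1C.
- exact: t0.
- by move=> g h cg ch; rewrite transferD transferN rpredB.
- move=> x xI Ix; have [[i ni <-]|[i ni /andP[ax xa]]] := part_cover pm xI.
    exact: cpart.
  by apply: (step i) => //; [rewrite !ltW|exact: cpart (ltnW ni)].
Qed.

End Assembly.

(** * Submodules of the dimension group *)

Section Submodule.
Variables (R : realType) (tau : R -> R) (n : nat) (a : nat -> R).
Local Notation C := (partition_set n a).
Local Notation I1 := (generalized_orbit tau C).
Local Notation X := (disconnection I1).
Variable sigma : X -> X.
Hypothesis pm : piecewise_monotonic tau n a.
Hypothesis sigma_assoc : associated_map sigma.
Implicit Types (x y c d : R) (i j : nat).
Local Notation T i := (branch tau a i.+1).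
Local Notation DG := (dim_group sigma).

Definition below_class x : DG := dg_class sigma (to_cont_int (below I1 x)).

Lemma to_cont_intE (f : X -> int) : f \in @continuous_int X ->
  to_cont_int f = f :> (X -> int).
Proof. by move=> cf; rewrite /to_cont_int insubdK. Qed.

Lemma below_contE x : I1 x -> to_cont_int (below I1 x) = below I1 x :> (X -> int).
Proof.
move=> Ix; rewrite to_cont_intE//; apply: below_cont => //.
exact: (orbit_itv pm Ix).
Qed.

Lemma below_class0 : below_class 0 = 0.
Proof.
congr dg_class; apply: val_inj => /=; rewrite /to_cont_int insubdK below0//.
exact: rpred0.
Qed.

Lemma dg_classB (f g : cont_int X) :
  dg_class sigma (f - g) = dg_class sigma f - dg_class sigma g :> DG.
Proof. by rewrite -dg_classD -dg_classN. Qed.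

Lemma ordered_interval_classE c d : I1 c -> I1 d -> c < d ->
  ordered_interval_class sigma c d = below_class d - below_class c.
Proof.
move=> Ic Id cd; have /andP[c0 c1] := orbit_itv pm Ic.
have /andP[d0 d1] := orbit_itv pm Id.
rewrite /below_class -dg_classB; congr dg_class; apply: val_inj => /=.
rewrite indic_itvE// !below_contE// /to_cont_int insubdK//.
by rewrite rpredB// below_cont// ?c0 ?d0.
Qed.

Variable N : set DG.
Hypothesis N_submod : laurent_submodule N.

(** For points of the orbit this says that the interval class of [x] and [y] is in [N]; as a
    difference it needs no case distinction on the order. *)
Definition below_rel x y := N (below_class y - below_class x).

Let N0 : N 0. Proof. by case: N_submod. Qed.

Let NB u v : N u -> N v -> N (u - v).
Proof. by case: N_submod => _ h _ _; exact: h. Qed.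

Let NN u : N (- u) <-> N u.
Proof.
have h v : N v -> N (- v) by move=> Nv; rewrite -sub0r; exact: NB.
by split => [/h|/h//]; rewrite opprK.
Qed.

Lemma below_rel_refl x : below_rel x x.
Proof. by rewrite /below_rel subrr. Qed.

Lemma below_rel_sym x y : below_rel x y -> below_rel y x.
Proof. by rewrite /below_rel => /NN; rewrite opprB. Qed.

Lemma below_rel_trans x y z : below_rel x y -> below_rel y z -> below_rel x z.
Proof.
rewrite /below_rel => xy /NN yz; rewrite -[_ z](subrK (below_class y)).
by rewrite -addrA addrC -[X in _ + X]opprK; exact: NB.
Qed.

Lemma interval_class_rel c d : I1 c -> I1 d ->
  N (interval_class sigma c d) <-> below_rel c d.
Proof.
move=> Ic Id; rewrite /interval_class /below_rel.
case: ltgtP => [cd|dc|->]; last by rewrite subrr.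
  by rewrite ordered_interval_classE.
by rewrite ordered_interval_classE// -NN opprB.
Qed.

(** Continuity of transfers is essential here: [to_cont_int] inside [dg_transfer] would turn a
    discontinuous function into 0. *)
Lemma dg_transfer_below i c d : (i < n)%N ->
  a i <= c <= a i.+1 -> a i <= d <= a i.+1 -> I1 c -> I1 d ->
  let u := below_class (T i d) - below_class (T i c) in
  dg_transfer (below_class d - below_class c) = u \/
  dg_transfer (below_class d - below_class c) = - u.
Proof.
move=> ni cI dI Ic Id /=.
have Tc := branch_orbit pm ni cI Ic; have Td := branch_orbit pm ni dI Id.
have cL (g : cont_int X) : transfer sigma g \in @continuous_int X.
  by apply: (transfer_continuous pm) => //; exact: cont_funP.
rewrite /below_class -!dg_classB (dg_transferE _ cL).
have [E|E] := transfer_below pm sigma_assoc ni cI dI Ic Id.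
  left; congr dg_class; apply: val_inj.
  by rewrite [LHS]to_cont_intE ?cL//= !below_contE.
right; rewrite [RHS]dg_classN; congr dg_class; apply: val_inj.
by rewrite [LHS]to_cont_intE ?cL//= !below_contE.
Qed.

(** The direct implication is stability of [N] under the transfer, the converse is stability under
    its preimage. *)
Lemma below_rel_branch i c d : (i < n)%N ->
  a i <= c <= a i.+1 -> a i <= d <= a i.+1 -> I1 c -> I1 d ->
  below_rel c d <-> below_rel (T i c) (T i d).
Proof.
move=> ni cI dI Ic Id; rewrite /below_rel; case: N_submod => _ _ NL NL'.
have [E|E] := dg_transfer_below ni cI dI Ic Id.
  split => [Ncd|NT].
    by rewrite -E; apply: NL; exists (below_class d - below_class c).
  by apply: NL'; rewrite /= E.
split => [Ncd|NT].
  by apply/NN; rewrite -E; apply: NL; exists (below_class d - below_class c).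
by apply: NL'; rewrite /= E; apply/NN.
Qed.

Lemma submodule_full M : hat_image tau C M ->
  (forall c d, adjacent (C `|` [set M]) c d -> N (interval_class sigma c d)) ->
  (forall i, (1 <= i < n)%N ->
     N (interval_class sigma (branch tau a i (a i)) (T i (a i)))) ->
  N = [set: DG].
Proof.
move=> [x0 Cx0 x0M] NJ1 NJ2.
have IC x : C x -> I1 x by exact: orbit_partition.
have Ia i : (i <= n)%N -> I1 (a i) by move=> ni; apply: IC; exact: partition_setP.
have IM : I1 M by exact: (orbit_hat (IC _ Cx0) x0M).
have aI i : (i < n)%N -> a i <= a i <= a i.+1.
  by move=> ni; rewrite lexx ltW// (part_ltS pm).
have aIS i : (i < n)%N -> a i <= a i.+1 <= a i.+1.
  by move=> ni; rewrite lexx ltW// (part_ltS pm).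
have ITl i : (i < n)%N -> I1 (T i (a i)).
  by move=> ni; exact: (orbit_hat (Ia _ (ltnW ni)) (hat_branch_left pm ni)).
have ITr i : (i < n)%N -> I1 (T i (a i.+1)).
  by move=> ni; exact: (orbit_hat (Ia _ ni) (hat_branch_right pm ni)).
have partN i j : (i < n)%N -> (j <= n)%N -> ~ (a i < a j < a i.+1).
  move=> ni nj /andP[ij ji]; have [ij'|ji'] := leqP j i.
    by have := part_le pm (introT andP (conj ij' (ltnW ni))); rewrite leNgt ij.
  by have := part_le pm (introT andP (conj ji' nj)); rewrite leNgt ji.
have adj c d : (C `|` [set M]) c -> (C `|` [set M]) d -> c < d ->
    (forall z, (C `|` [set M]) z -> ~ (c < z < d)) -> below_rel c d.
  move=> Cc Cd cd nz; apply/interval_class_rel.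
  - by case: Cc => [/IC//|->].
  - by case: Cd => [/IC//|->].
  - apply: NJ1; split => //; first by rewrite lt_eqF.
    by rewrite min_l ?max_r ?(ltW cd).
(* When [M] falls inside a piece, it is adjacent to both ends, which are no longer adjacent to each
   other; [rS] then has to pass through [M]. *)
have rM i : (i < n)%N -> a i < M < a i.+1 ->
    below_rel (a i) M /\ below_rel M (a i.+1).
  move=> ni /andP[aM Ma]; split; apply: adj => //.
  - by left; apply: partition_setP; exact: ltnW.
  - by right.
  - move=> z [[j nj <-]|->] /andP[iz zM]; last by rewrite ltxx in zM.
    by apply: (partN i j) => //; rewrite iz (lt_trans zM).
  - by right.
  - by left; apply: partition_setP.
  - move=> z [[j nj <-]|->] /andP[iz zM]; last by rewrite ltxx in iz.
    by apply: (partN i j) => //; rewrite zM (lt_trans aM).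
have rS i : (i < n)%N -> below_rel (a i) (a i.+1).
  move=> ni; have [iM|niM] := boolP (a i < M < a i.+1).
    by have [r1 r2] := rM _ ni iM; exact: (below_rel_trans r1 r2).
  apply: adj.
  - by left; apply: partition_setP; exact: ltnW.
  - by left; apply: partition_setP.
  - exact: (part_ltS pm).
  - by move=> z [[j nj <-]|->]; [exact: partN|exact/negP].
have r0 i : (i <= n)%N -> below_rel (a 0%N) (a i).
  elim: i => [_|i IHi ni]; first exact: below_rel_refl.
  by apply: below_rel_trans (rS _ ni); apply: IHi; exact: ltnW.
have r0M : below_rel (a 0%N) M.
  have [[i ni <-]|[i ni iM]] := part_cover pm (orbit_itv pm IM); first exact: r0.
  by have [r1 _] := rM _ ni iM; apply: below_rel_trans r1; apply: r0; exact: ltnW.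
(* A representative of the class of all one-sided limits at the partition points. *)
pose y0 := T 0%N (a 0%N).
have rT i : (i < n)%N -> below_rel (a i) (a i.+1) ->
    below_rel (T i (a i)) (T i (a i.+1)).
  move=> ni.
  by move/(below_rel_branch ni (aI _ ni) (aIS _ ni) (Ia _ (ltnW ni)) (Ia _ ni)).
have rTz i z : (i < n)%N -> a i < z < a i.+1 -> I1 z ->
    below_rel (a i) z <-> below_rel (T i (a i)) (tau z).
  move=> ni iz Iz; rewrite -(branch_in _ iz).
  apply: (below_rel_branch ni (aI _ ni) _ (Ia _ (ltnW ni)) Iz).
  by case/andP: iz => /ltW -> /ltW ->.
(* Induction along the partition: [rT] links the two end values of a branch, and [NJ2] links the
   left and right limits at the common end of two branches. *)
have ry i : (i < n)%N -> below_rel y0 (T i (a i)) /\ below_rel y0 (T i (a i.+1)).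
  elim: i => [n0|i IHi ni].
    split; first exact: below_rel_refl.
    exact: (rT _ n0 (rS _ n0)).
  have [_ r1] := IHi (ltnW ni).
  have r2 : below_rel y0 (T i.+1 (a i.+1)).
    apply: below_rel_trans r1 _; apply/interval_class_rel.
    - exact: (ITr _ (ltnW ni)).
    - exact: ITl.
    - by apply: NJ2; rewrite ni.
  split=> //; apply: below_rel_trans r2 _.
  exact: (rT _ ni (rS _ ni)).
have ryhat i y : (i <= n)%N -> hat tau (a i) y -> below_rel y0 y.
  move=> ni /(hat_partition pm ni)[[j ij ->]|[i_n ->]]; last by case: (ry _ i_n).
  by rewrite ij in ni; case: (ry _ ni).
(* [M] is itself a limit at a partition point, so it is related to [y0]; with [r0M] this merges the
   two classes. *)
have r0y : below_rel (a 0%N) y0.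
  apply: below_rel_trans r0M _; apply: below_rel_sym.
  by case: Cx0 x0M => i ni <-; exact: ryhat.
have rI x : I1 x -> below_rel (a 0%N) x.
  (* Membership in the orbit is kept in [E] because [rTz] requires it. *)
  pose E := [set x | I1 x /\ below_rel (a 0%N) x].
  suff : I1 `<=` E by move=> /[apply] -[].
  apply: smallest_sub; last by move=> _ [i ni <-]; split; [exact: Ia|exact: r0].
  split.
  - by move=> y [Iy _]; rewrite /unit_itv/= in_itv/=; exact: (orbit_itv pm Iy).
  - move=> y [z [Iz rz] zy]; split; first exact: (orbit_hat Iz zy).
    have [[i ni zE]|[i ni iz]] := part_cover pm (orbit_itv pm Iz).
      by apply: below_rel_trans r0y _; apply: (ryhat i) => //; rewrite zE.
    move: zy => /(hat_between pm y ni iz) ->.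
    have [r1 _] := ry _ ni; apply: below_rel_trans (below_rel_trans r0y r1) _.
    apply: (proj1 (rTz _ _ ni iz Iz)).
    by apply: below_rel_trans rz; apply/below_rel_sym/r0/ltnW.
  - move=> z [zI [y [zy [Iy ryy]]]].
    have zI' : 0 <= z <= 1 by move: zI; rewrite /unit_itv/= in_itv.
    have Iz : I1 z by exact: (orbit_hat_preimage zI' zy Iy).
    split=> //; have [[i ni <-]|[i ni iz]] := part_cover pm zI'; first exact: r0.
    move: zy ryy => /(hat_between pm y ni iz) -> rz.
    apply: below_rel_trans (r0 _ (ltnW ni)) _; apply: (proj2 (rTz _ _ ni iz Iz)).
    have [r1 _] := ry _ ni; apply: below_rel_trans rz.
    by apply: below_rel_sym; exact: (below_rel_trans r0y r1).
apply/seteqP; split => // u _; have [f ->] := dg_classE u.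
(* [cont_int_ind] speaks of bare functions, so membership in [N] is expressed through a bundled
   function with the same values. *)
suff [g gf Ng] : exists2 g : cont_int X, g = f :> (X -> int) & N (dg_class sigma g).
  by rewrite (_ : f = g)//; exact: val_inj.
apply: (@cont_int_ind _ I1 (fun f => exists2 g : cont_int X, g = f :> (X -> int) &
   N (dg_class sigma g))).
- by rewrite -(partn pm); exact: Ia.
- by exists 0 => //; exact: N0.
- move=> _ _ [g <- Ng] [h <- Nh]; exists (g - h) => //.
  by rewrite dg_classB; exact: NB.
- move=> x xI Ix; exists (to_cont_int (below I1 x)); first exact: below_contE.
  (* As [below_class 0] vanishes, being related to [a 0 = 0] means that [below_class x] itself is in
     [N]. *)
  by have := rI _ Ix; rewrite /below_rel (part0 pm) below_class0 subr0.
- exact: cont_funP.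
Qed.

End Submodule.

Theorem theorem6p2 (R : realType) (tau : R -> R) (n : nat) (a : nat -> R)
    (sigma : disconnection (generalized_orbit tau (partition_set n a)) ->
             disconnection (generalized_orbit tau (partition_set n a)))
    (M : R) :
  piecewise_monotonic tau n a ->
  maximal_partition tau n a ->
  eventually_surjective tau (partition_set n a) ->
  associated_map sigma ->
  hat_image tau (partition_set n a) M ->
  laurent_span
    ([set u | exists c d : R, adjacent (partition_set n a `|` [set M]) c d /\
                              u = interval_class sigma c d] `|`
     [set interval_class sigma (branch tau a i (a i)) (branch tau a i.+1 (a i))
       | i in [set i : nat | (1 <= i < n)%N]])
  = [set: dim_group sigma].
Proof.
(* The span is an intersection, so each submodule [N] containing the generators is to be shown
   full. *)
move=> pm _ _ sa MC; apply/seteqP; split => // u _ N [Nsub NJ].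
rewrite (submodule_full pm sa Nsub MC)// => [c d cd|i ni]; apply: NJ.
  by left; exists c, d.
by right; exists i.
Qed.
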